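(* Let $p>1$ and let $s,q,V:\mathbb{R}^3\to(0,\infty)$ be radially symmetric $C^2$-functions. Put $T=2\pi\sqrt{s(0)/q(0)}$. Assume: (H1) $T\sqrt{q(x)/s(x)}<2\pi$ for all $x\in\mathbb{R}^3\setminus\{0\}$; (H2) $\bigl|2\pi-T\sqrt{q(x)/s(x)}\bigr|^{\frac{1}{p-1}}\to 0$ in the $C^2$-sense as $x\to 0$; (H3) $\sup_{x\in\mathbb{R}^3}\bigl|2\pi-T\sqrt{q(x)/s(x)}\bigr|\,e^{\delta(p-1)|x|}<\infty$ for some $\delta>0$; (H4) $\sup_{x\in\mathbb{R}^3} q(x)/V(x)<\infty$. Then there exists a classical ($C^2$) solution $U:\mathbb{R}^3\times\mathbb{R}\to\mathbb{R}^3$ of $$s(x)\partial_t^2U+\nabla\times\nabla\times U+q(x)U+V(x)|U|^{p-1}U=0\quad\text{for }(x,t)\in\mathbb{R}^3\times\mathbb{R},$$ which is $T$-periodic in $t$ and satisfies $\sup_{\mathbb{R}^3\times\mathbb{R}}|U(x,t)|e^{\delta|x|}<\infty$ (with $\delta$ from (H3)). Moreover, for every radially symmetric $C^2$-function $a:\mathbb{R}^3\to\mathbb{R}$, the function $U_a(x,t)=U(x,t+a(x))$ is also such a $T$-periodic breather solution of the same equation.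
   Context: A function $f:\mathbb{R}^3\to\mathbb{R}$ is radially symmetric if $f(x)$ depends only on $|x|$. For $f:\mathbb{R}^3\to\mathbb{R}$ one says $f(x)\to 0$ in the $C^2$-sense as $x\to 0$ if $f(x)\to0$, $\nabla f(x)\to 0$ and $D^2f(x)\to 0$ as $x\to 0$. A breather is a time-periodic, spatially localized real-valued solution. *)

(* Defs.v *)
From HB Require Import structures.
From mathcomp Require Import all_boot all_order all_algebra.
From mathcomp Require Import all_classical all_reals all_analysis.
Set Implicit Arguments. Unset Strict Implicit. Unset Printing Implicit Defensive.
Import Order.TTheory GRing.Theory Num.Theory.
Import numFieldNormedType.Exports.
Local Open Scope ring_scope.
Local Open Scope classical_set_scope.

Definition evec {R : realType} {n : nat} (i : 'I_n) : 'rV[R]_n := delta_mx 0 i.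

(* Euclidean norm (the library's norm on 'rV is the sup norm) *)
Definition enorm {R : realType} {n : nat} (x : 'rV[R]_n) : R :=
  Num.sqrt (\sum_(i < n) x 0 i ^+ 2).

Definition pd {R : realType} {n : nat} {W : normedModType R}
  (i : 'I_n) (f : 'rV[R]_n -> W) : 'rV[R]_n -> W :=
  fun x => derive f x (evec i).

Definition C2 {R : realType} {n : nat} {W : normedModType R}
  (f : 'rV[R]_n -> W) : Prop :=
  continuous f /\
  forall i j : 'I_n,
    (forall x, derivable f x (evec i)) /\ continuous (pd i f) /\
    (forall x, derivable (pd i f) x (evec j)) /\ continuous (pd j (pd i f)).

Definition radial {R : realType} {n : nat} (f : 'rV[R]_n -> R) : Prop :=
  forall x y : 'rV[R]_n, enorm x = enorm y -> f x = f y.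

Definition i0 : 'I_3 := @Ordinal 3 0 isT.
Definition i1 : 'I_3 := @Ordinal 3 1 isT.
Definition i2 : 'I_3 := @Ordinal 3 2 isT.

(* curl of a vector field F : R^3 -> R^3 ; (pd i F x) 0 k = d_i F_k (x) *)
Definition curl {R : realType} (F : 'rV[R]_3 -> 'rV[R]_3) : 'rV[R]_3 -> 'rV[R]_3 :=
  fun x => \row_(k < 3)
    (if val k == 0%N then pd i1 F x 0 i2 - pd i2 F x 0 i1
     else if val k == 1%N then pd i2 F x 0 i0 - pd i0 F x 0 i2
     else pd i0 F x 0 i1 - pd i1 F x 0 i0).

Definition joint {R : realType} (U : 'rV[R]_3 -> R -> 'rV[R]_3)
  : 'rV[R]_(3 + 1) -> 'rV[R]_3 :=
  fun z => U (lsubmx z) (rsubmx z 0 0).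

Definition dtt {R : realType} (U : 'rV[R]_3 -> R -> 'rV[R]_3) (x : 'rV[R]_3) (t : R)
  : 'rV[R]_3 :=
  derive (fun t' : R => derive (fun tau : R => U x tau) t' 1) t 1.

Definition classical_solution {R : realType} (s q V : 'rV[R]_3 -> R) (p : R)
  (U : 'rV[R]_3 -> R -> 'rV[R]_3) : Prop :=
  C2 (joint U) /\
  forall x t,
    s x *: dtt U x t + curl (curl (fun y => U y t)) x + q x *: U x t
    + (V x * (enorm (U x t) `^ (p - 1))) *: U x t = 0.

Definition breather {R : realType} (s q V : 'rV[R]_3 -> R) (p T delta : R)
  (U : 'rV[R]_3 -> R -> 'rV[R]_3) : Prop :=
  classical_solution s q V p U /\
  (forall x t, U x (t + T) = U x t) /\
  (exists C : R, forall x t, enorm (U x t) * expR (delta * enorm x) <= C).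

(* Main.v *)
(** Separate the direction from the profile: U(x,t) = psi(x,t) x/|x| with psi radial in x is
    curl free, so the equation is the scalar ODE s psi'' + q psi + V |psi|^(p-1) psi = 0 at each
    x, and a radial time shift changes nothing. Scaling psi by (q/V)^(1/(p-1)) and time by
    (q/s)^(1/2) reduces it to z'' + z + |z|^(p-1) z = 0. Write z = c sin th and u = c^(p-1);
    conservation of energy becomes th'^2 = 1 + u kappa(th), where
    kappa(th) = (1 - |sin th|^(p+1)) / ((p+1)/2 cos^2 th) is continuous with values in (0,1].
    Hence time is the integral of (1 + u kappa)^(-1/2) over the phase, which is smooth in u up to
    u = 0 even when the nonlinearity is only C^1, and the period L(u) decreases from 2 pi to 0.
    Choose u(x) by L(u(x)) = T (q(x)/s(x))^(1/2). Since 2 pi - L(u) = u m(u) with m > 0 smooth,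
    u(x) is C^2, and the amplitude c(x) = u(x)^(1/(p-1)) is a C^2 function times
    h(x) = |2 pi - T (q(x)/s(x))^(1/2)|^(1/(p-1)). Hypothesis (H2) says precisely that
    h(x) x/|x| is C^2 at the origin, and (H3), (H4) give the exponential decay. *)

Require Import Defs.
From HB Require Import structures.
From mathcomp Require Import all_boot all_order all_algebra.
From mathcomp Require Import all_classical all_reals all_analysis.
From mathcomp Require Import ring lra.
Import Order.TTheory GRing.Theory Num.Theory.
Import numFieldNormedType.Exports.
Local Open Scope ring_scope.
Local Open Scope classical_set_scope.
Set Implicit Arguments. Unset Strict Implicit. Unset Printing Implicit Defensive.

(** * One-variable calculus *)

Section OneVariable.
Context {R : realType}.
Implicit Types (f df g : R -> R) (x y : R).

(** Of [kappa] only continuity is established, so the phase, obtained by inverting time, is shown to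
    be C1 and no better, while the solution must be C2. The energy closes this gap: the gradient of
    [sin th] involves [th] only through [om = cos th / rr] and the [w]-derivative of time. The
    square of [om] is an explicit expression in [sin th] and [cos th], free of the quotient [kappa];
    hence [om] is C1, and its derivative along the motion is the differential equation. The origin
    corresponds to [u = 0], an endpoint of the admissible range. Writing [u = expR w - 1] with [w]
    ranging over all reals puts [w = 0] in the interior, so that every implicit function is global
    and no one-sided derivative occurs. *)

Lemma MVT_between f df x y :
  (forall z, Num.min x y < z < Num.max x y -> is_derive z 1 f (df z)) ->
  {for x, continuous f} -> {for y, continuous f} ->
  exists2 z, Num.min x y <= z <= Num.max x y & f y - f x = df z * (y - x).
Proof.
wlog lt_xy : x y / x < y.
  move=> wl dfE cx cy; have [->|] := eqVneq x y.
    by exists y; [rewrite minxx maxxx lexx|rewrite !subrr mulr0].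
  rewrite neq_lt => /orP[xy|yx]; first exact: wl.
  - have [|z zxy E] := wl _ _ yx _ cy cx; first by rewrite minC maxC.
    by exists z; [rewrite minC maxC|rewrite -opprB E -mulrN opprB].
rewrite min_l ?max_r ?ltW// => dfE cx cy.
have dfI z : z \in `]x, y[%R -> is_derive z 1 f (df z) by rewrite in_itv/= => /dfE.
have [|z zxy E] := MVT lt_xy dfI; last first.
  by exists z => //; move: zxy; rewrite in_itv/= => /andP[/ltW-> /ltW->].
apply/continuous_within_itvP => //; split.
- by move=> z /dfI zf; apply/differentiable_continuous/derivable1_diffP.
- exact: cvg_at_right_filter cx.
- exact: cvg_at_left_filter cy.
Qed.

Lemma is_derive_continuous f x (d : R) : is_derive x 1 f d -> {for x, continuous f}.
Proof. by move=> fx; apply/differentiable_continuous/derivable1_diffP. Qed.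

Lemma between_dist (x y z : R) :
  Num.min x y <= z <= Num.max x y -> `|z - x| <= `|y - x|.
Proof.
have [xy|yx] := leP x y => /andP[z1 z2].
  by rewrite !ger0_norm ?subr_ge0// lerD2r.
by rewrite !ler0_norm ?subr_le0 ?(ltW yx)// lerN2 lerD2r.
Qed.

Lemma near_is_derive_slope f x (d : R) g :
  (\forall y \near x, f y - f x = g y * (y - x)) ->
  {for x, continuous g} -> g x = d -> is_derive x 1 f d.
Proof.
move=> fg cg gx; apply/is_derive1_caratheodory.
exists (fun y => if y == x then d else (f y - f x) / (y - x)).
rewrite eqxx; split => //.
  move=> z; case: eqP => [->|/eqP zx]; first by rewrite !subrr mulr0.
  by rewrite divfK// subr_eq0.
rewrite /prop_for /continuous_at eqxx -gx.
apply: cvg_trans cg; apply: near_eq_cvg; near=> y.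
case: eqP => [->|/eqP yx]; first by [].
by rewrite (near fg y)// mulfK// subr_eq0.
Unshelve. all: by end_near. Qed.

(** By the mean value theorem the difference quotients at [x] are values of [df] at nearer points.
    It serves wherever a formula fails at a single point: the seam of two primitives, and the
    origin. *)
Lemma is_derive_extension f df x (l : R) :
  {for x, continuous f} -> (\forall y \near x^', is_derive (y : R) (1 : R) f (df y)) ->
  df y @[y --> x^'] --> l -> is_derive x 1 f l.
Proof.
move=> cf fdf dfl.
pose s y := if y == x then l else (f y - f x) / (y - x).
apply: (@near_is_derive_slope _ _ _ s); last by rewrite /s eqxx.
  near=> y; rewrite /s; case: eqP => [->|/eqP yx]; first by rewrite !subrr mulr0.
  by rewrite divfK// subr_eq0.
apply/cvgrPdist_le => e e0; rewrite /s eqxx.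
have /cvgrPdist_le/(_ _ e0) := dfl.
rewrite near_withinE => dfe.
have {}fdf : \forall y \near x, y != x -> is_derive (y : R) (1 : R) f (df y).
  by move: fdf; rewrite near_withinE.
have /nbhs_ballP[d /= d0 dP] : \forall y \near x, y != x ->
    is_derive (y : R) (1 : R) f (df y) /\ `|l - df y| <= e.
  by apply: filterS2 fdf dfe => y h1 h2 yx; split; [apply: h1|apply: h2].
suff : \forall y \near x, `|l - s y| <= e by [].
near=> y; rewrite /s; have [_|yx] := eqVneq y x; first by rewrite subrr normr0 ltW.
have yd : ball x d y by near: y; apply: nbhsx_ballx.
have {}yd : `|y - x| < d by move: yd; rewrite -ball_normE/= distrC.
(* The intermediate point may be [x] itself, where [f] is not yet known to be derivable; with the
   value [l] there the error is zero. *)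
pose k z := if z == x then l else df z.
have kP z : Num.min x y < z < Num.max x y -> is_derive z 1 f (k z).
  move=> zxy; have zx : z != x.
    apply: contraTneq zxy => ->; have [xy|xy] := leP x y; rewrite ?ltxx//.
    by rewrite andbF.
  rewrite /k (negbTE zx); apply: (dP z _ zx).1.
  rewrite -ball_normE/= distrC; apply: (@le_lt_trans _ _ `|y - x|) => //.
  apply: between_dist.
  by case/andP: zxy => /ltW-> /ltW->.
have byd : ball x d y by rewrite -ball_normE/= distrC.
have [z zxy E] := MVT_between kP cf (is_derive_continuous (dP y byd yx).1).
rewrite E mulfK ?subr_eq0// /k; case: eqP => [_|/eqP zx].
  by rewrite subrr normr0 ltW.
apply: (dP z _ zx).2; rewrite -ball_normE/= distrC.
exact: le_lt_trans (between_dist zxy) yd.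
Unshelve. all: by end_near. Qed.

Lemma bounded_derive_le f df (K e x : R) :
  (forall z : R, `|z| <= K -> is_derive z 1 f (df z)) ->
  (forall z : R, `|z| <= K -> `|df z| <= e) -> f 0 = 0 ->
  `|x| <= K -> `|f x| <= e * `|x|.
Proof.
move=> fdf dfe f0 xK.
have zK z : Num.min 0 x <= z <= Num.max 0 x -> `|z| <= K.
  by move=> /between_dist; rewrite !subr0 => /le_trans; apply.
have dfz z : Num.min 0 x < z < Num.max 0 x -> is_derive z 1 f (df z).
  by move=> /andP[/ltW z1 /ltW z2]; apply/fdf/zK; rewrite z1.
have K0 : `|0 : R| <= K by rewrite normr0; apply: le_trans xK.
have [z zx] := MVT_between dfz (is_derive_continuous (fdf _ K0))
  (is_derive_continuous (fdf _ xK)).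
by rewrite f0 !subr0 => ->; rewrite normrM ler_wpM2r// dfe// zK.
Qed.

Lemma is_derive1_ext f g x (d : R) : f =1 g -> is_derive x 1 f d -> is_derive x 1 g d.
Proof. by move=> /funext ->. Qed.

End OneVariable.

(** * Chain rule and implicit functions in two variables *)

Section TwoVariables.
Context {R : realType}.
Implicit Types (E : R -> R -> R).

Lemma continuous_comp_two (T : topologicalType) (E : R * R -> R) (a b : T -> R) t :
  {for (a t, b t), continuous E} ->
  {for t, continuous a} -> {for t, continuous b} ->
  {for t, continuous (fun s => E (a s, b s))}.
Proof.
move=> cE ca cb; rewrite /prop_for /continuous_at.
have cab : (a s, b s) @[s --> t] --> (a t, b t) by exact: cvg_pair ca cb.
exact: cvg_comp cab cE.
Qed.

Definition continuous2 E := continuous (fun z : R * R => E z.1 z.2).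

Definition C1two E E1 E2 := [/\
  (forall u v : R, is_derive u 1 (E^~ v) (E1 u v)),
  (forall u v : R, is_derive v 1 (E u) (E2 u v)),
  continuous2 E1 & continuous2 E2].

(* A joint Caratheodory slope replaces Frechet differentiability: it needs one-variable mean
   value theorems only, and gives both the chain rule and implicit differentiation. *)
Lemma caratheodory2 E E1 E2 (u0 v0 : R) : C1two E E1 E2 ->
  exists s1 s2 : R * R -> R,
   [/\ forall u v, E u v - E u0 v0 = s1 (u, v) * (u - u0) + s2 (u, v) * (v - v0),
       {for (u0, v0), continuous s1}, {for (u0, v0), continuous s2},
       s1 (u0, v0) = E1 u0 v0 & s2 (u0, v0) = E2 u0 v0].
Proof.
move=> [d1 d2 c1 c2].
have [x1 x1P] : {x1 : R * R -> R & forall z, `|x1 z - u0| <= `|z.1 - u0| /\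
    E z.1 z.2 - E u0 z.2 = E1 (x1 z) z.2 * (z.1 - u0)}.
  apply: (@choice _ _ (fun z y => `|y - u0| <= `|z.1 - u0| /\
    E z.1 z.2 - E u0 z.2 = E1 y z.2 * (z.1 - u0))) => z.
  have [y /between_dist yz H] := MVT_between (fun y _ => d1 y z.2)
    (is_derive_continuous (d1 u0 z.2)) (is_derive_continuous (d1 z.1 z.2)).
  by exists y.
have [x2 x2P] : {x2 : R * R -> R & forall z, `|x2 z - v0| <= `|z.2 - v0| /\
    E u0 z.2 - E u0 v0 = E2 u0 (x2 z) * (z.2 - v0)}.
  apply: (@choice _ _ (fun z y => `|y - v0| <= `|z.2 - v0| /\
    E u0 z.2 - E u0 v0 = E2 u0 y * (z.2 - v0))) => z.
  have [y /between_dist yz H] := MVT_between (fun y _ => d2 u0 y)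
    (is_derive_continuous (d2 u0 v0)) (is_derive_continuous (d2 u0 z.2)).
  by exists y.
(* The intermediate points come from choice and may jump elsewhere; at [(u0, v0)] the bound by the
   increment forces continuity. *)
have cx1 : {for (u0, v0), continuous x1}.
  have e : x1 (u0, v0) = u0.
    by apply/eqP; rewrite -subr_eq0 -normr_le0 (le_trans (x1P _).1)//= subrr normr0.
  rewrite /prop_for /continuous_at e; apply/cvgrPdist_lt => e1 e0.
  have /cvgrPdist_lt/(_ _ e0) : fst @ (u0, v0) --> u0 by apply: cvg_fst.
  apply: filterS => z; rewrite distrC => ze; rewrite distrC.
  exact: le_lt_trans (x1P z).1 ze.
have cx2 : {for (u0, v0), continuous x2}.
  have e : x2 (u0, v0) = v0.
    by apply/eqP; rewrite -subr_eq0 -normr_le0 (le_trans (x2P _).1)//= subrr normr0.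
  rewrite /prop_for /continuous_at e; apply/cvgrPdist_lt => e1 e0.
  have /cvgrPdist_lt/(_ _ e0) : snd @ (u0, v0) --> v0 by apply: cvg_snd.
  apply: filterS => z; rewrite distrC => ze; rewrite distrC.
  exact: le_lt_trans (x2P z).1 ze.
have e1 : x1 (u0, v0) = u0.
  by apply/eqP; rewrite -subr_eq0 -normr_le0 (le_trans (x1P _).1)//= subrr normr0.
have e2 : x2 (u0, v0) = v0.
  by apply/eqP; rewrite -subr_eq0 -normr_le0 (le_trans (x2P _).1)//= subrr normr0.
exists (fun z => E1 (x1 z) z.2), (fun z => E2 u0 (x2 z)); split.
- move=> u v; rewrite -(x1P (u, v)).2 -(x2P (u, v)).2/=; ring.
- exact: (continuous_comp_two (c1 _) cx1 cvg_snd).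
- exact: (continuous_comp_two (c2 _) (cvg_cst _) cx2).
- by rewrite e1.
- by rewrite e2.
Qed.

Lemma C1two_continuous2 E E1 E2 : C1two E E1 E2 -> continuous2 E.
Proof.
move=> CE [u0 v0]; have [s1 [s2 [sE cs1 cs2 _ _]]] := caratheodory2 u0 v0 CE.
have -> : (fun z : R * R => E z.1 z.2) =
    fun z => E u0 v0 + (s1 z * (z.1 - u0) + s2 z * (z.2 - v0)).
  by apply/funext => -[u v] /=; rewrite -sE addrC subrK.
apply: cvgD; first exact: cvg_cst.
apply: cvgD; apply: cvgM => //; apply: cvgB; try exact: cvg_cst.
- exact: cvg_fst.
- exact: cvg_snd.
Qed.

Lemma is_derive_comp2 E E1 E2 (a b : R -> R) (t da db : R) : C1two E E1 E2 ->
  is_derive t 1 a da -> is_derive t 1 b db ->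
  is_derive t 1 (fun h => E (a h) (b h)) (E1 (a t) (b t) * da + E2 (a t) (b t) * db).
Proof.
move=> CE da_ db_; have [s1 [s2 [sE cs1 cs2 s1E s2E]]] := caratheodory2 (a t) (b t) CE.
have /is_derive1_caratheodory[A [Aa cA At]] := da_.
have /is_derive1_caratheodory[B [Bb cB Bt]] := db_.
apply/is_derive1_caratheodory.
exists (fun h => s1 (a h, b h) * A h + s2 (a h, b h) * B h); split.
- by move=> z; rewrite sE Aa Bb; ring.
- have cab : (a h, b h) @[h --> t] --> (a t, b t).
    exact: cvg_pair (is_derive_continuous da_) (is_derive_continuous db_).
  apply: cvgD; apply: cvgM => //.
  + exact: cvg_comp cab cs1.
  + exact: cvg_comp cab cs2.
- by rewrite s1E s2E At Bt.
Qed.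

(** With the slopes of [E] the constraint becomes a linear equation for the increment of [th];
    continuity of [th] keeps the coefficient [s2] nonzero near [t], so it can be solved. *)
Lemma is_derive_implicit E E1 E2 (W b th : R -> R) (t dW db : R) : C1two E E1 E2 ->
  E2 (W t) (th t) != 0 -> {for t, continuous th} ->
  (forall h, E (W h) (th h) = b h) ->
  is_derive t 1 W dW -> is_derive t 1 b db ->
  is_derive t 1 th ((db - E1 (W t) (th t) * dW) / E2 (W t) (th t)).
Proof.
move=> CE E2n cth Eb dW_ db_.
have [s1 [s2 [sE cs1 cs2 s1E s2E]]] := caratheodory2 (W t) (th t) CE.
have /is_derive1_caratheodory[A [AW cA At]] := dW_.
have /is_derive1_caratheodory[B [Bb cB Bt]] := db_.
have cab : (W h, th h) @[h --> t] --> (W t, th t).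
  exact: cvg_pair (is_derive_continuous dW_) cth.
have c1 : (s1 (W h, th h)) @[h --> t] --> s1 (W t, th t).
  exact: cvg_comp cab cs1.
have c2 : (s2 (W h, th h)) @[h --> t] --> s2 (W t, th t).
  exact: cvg_comp cab cs2.
apply: (@near_is_derive_slope _ _ _ _
   (fun h => (B h - s1 (W h, th h) * A h) / s2 (W h, th h))).
- have n2 : \forall h \near t, s2 (W h, th h) != 0.
    apply: (cvgr_neq0 _ c2); rewrite s2E//.
  near=> h; have s2h : s2 (W h, th h) != 0 by near: h.
  have := sE (W h) (th h); rewrite !Eb Bb AW => H.
  rewrite -mulrAC; apply: (canRL (mulfK s2h)).
  rewrite [LHS]mulrC [RHS]mulrBl H; ring.
- apply: cvgM; first by apply: cvgB => //; apply: cvgM.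
  by apply: cvgV => //; rewrite s2E.
- by rewrite s1E s2E At Bt.
Unshelve. all: by end_near. Qed.

(** Monotonicity traps [th h]: for [h] near [t], the values of [E (W h)] at [th t - e] and
    [th t + e] stay on either side of [b h]. *)
Lemma continuous_implicit (T : topologicalType) E (W b th : T -> R) (t : T) :
  continuous2 E -> (forall u, {homo E u : x y / x < y}) ->
  (forall h, E (W h) (th h) = b h) ->
  {for t, continuous W} -> {for t, continuous b} -> {for t, continuous th}.
Proof.
move=> cE incE Eb cW cb; apply/cvgrPdist_lt => e e0.
have leE u x y : E u x < E u y -> x < y.
  move=> lE; rewrite ltNge; apply: contraTN lE; rewrite -leNgt le_eqVlt.
  by move=> /predU1P[->//|/incE/ltW].
have cf c : E (W h) c - b h @[h --> t] --> E (W t) c - b t.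
  apply: cvgB => //.
  exact: (continuous_comp_two (cE _) cW (cvg_cst _)).
have n1 : \forall h \near t, 0 < E (W h) (th t + e) - b h.
  by apply: (cvgr_gt _ (cf _)); rewrite subr_gt0 -Eb incE// ltrDl.
have n2 : \forall h \near t, E (W h) (th t - e) - b h < 0.
  by apply: (cvgr_lt _ (cf _)); rewrite subr_lt0 -Eb incE// ltrBlDr ltrDl.
near=> h.
have : E (W h) (th h) < E (W h) (th t + e) by rewrite Eb -subr_gt0; near: h.
have : E (W h) (th t - e) < E (W h) (th h) by rewrite Eb -subr_lt0; near: h.
move=> /leE h1 /leE h2; rewrite ltr_norml; apply/andP; split; lra.
Unshelve. all: by end_near. Qed.

End TwoVariables.

(** * Primitives depending on a parameter *)

Section Primitive.
Context {R : realType}.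
Implicit Types (f : R -> R).

Local Notation mu := (@lebesgue_measure R).

Let prim f (x : R) : R := (\int[mu]_(t in `[(- 1)%R, x]) f t)%R.

Let is_derive_prim f (x : R) : continuous f -> -1 < x -> is_derive x 1 (prim f) (f x).
Proof.
move=> cf x1; have fi : mu.-integrable `[-1, x + 1] (EFin \o f).
  apply: continuous_compact_integrable; first exact: segment_compact.
  exact: continuous_subspaceT.
have xx1 : x < x + 1 by rewrite ltrDl.
have [d <-] := continuous_FTC1_closed xx1 fi x1 (cf x).
by rewrite derive1E; apply: derivableP.
Qed.

(** Integrating from [-1] makes [0] an interior point for [A], and, after the reflection
    [x |-> - f (- x)], for [B]. Both are therefore continuous at the seam [0], where
    [is_derive_extension] supplies the derivative. *)
Lemma exists_primitive f : continuous f ->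
  exists G : R -> R, G 0 = 0 /\ forall x : R, is_derive x 1 G (f x).
Proof.
move=> cf; pose fo x := - f (- x).
have cfo : continuous fo.
  move=> x; apply: cvgN; apply: (@cvg_comp _ _ _ -%R f _ (nbhs (- x))).
    exact: opp_continuous.
  exact: cf.
pose A x := prim f x - prim f 0.
pose B x := prim fo (- x) - prim fo 0.
have dA (x : R) : -1 < x -> is_derive x 1 A (f x).
  move=> /(is_derive_prim cf) ?; rewrite /A.
  by apply: is_derive_eq; rewrite subr0.
have dB (x : R) : x < 1 -> is_derive x 1 B (f x).
  move=> x1; have x1' : -1 < - x by rewrite ltrN2.
  have ? := is_derive_prim cfo x1'; have ? : is_derive x 1 (-%R) (-1 : R).
    exact: is_deriveNid.
  have -> : B = (prim fo \o -%R) - cst (prim fo 0) by [].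
  by apply: is_derive_eq; rewrite subr0 /fo opprK mulrN1 opprK.
have A0 : A 0 = 0 by rewrite /A subrr.
have B0 : B 0 = 0 by rewrite /B oppr0 subrr.
pose G x := if 0 <= x then A x else B x.
have dG (x : R) : x != 0 -> is_derive x 1 G (f x).
  rewrite neq_lt => /orP[] x0.
  - apply: near_eq_is_derive (dB _ (lt_trans x0 ltr01)).
    have : \forall y \near x, y < 0 by apply: lt_nbhsl.
    by apply: filterS => y y0; rewrite /G leNgt y0.
  - apply: near_eq_is_derive (dA _ (lt_trans (ltrN10 _) x0)).
    have : \forall y \near x, 0 < y by apply: lt_nbhsr.
    by apply: filterS => y y0; rewrite /G ltW.
exists G; split; first by rewrite /G lexx.
move=> x; have [->|] := eqVneq x 0; last exact: dG.
apply: (@is_derive_extension _ _ f).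
- rewrite /prop_for /continuous_at {2}/G lexx A0.
  have cA : A y @[y --> 0] --> 0.
    by rewrite -[X in _ --> X]A0; apply: is_derive_continuous (dA _ (ltrN10 _)).
  have cB : B y @[y --> 0] --> 0.
    by rewrite -[X in _ --> X]B0; apply: is_derive_continuous (dB _ ltr01).
  apply/cvgrPdist_lt => e e0.
  move/cvgrPdist_lt : cA => /(_ _ e0); move/cvgrPdist_lt : cB => /(_ _ e0).
  by apply: filterS2 => y; rewrite /G; case: ifP.
- by rewrite near_withinE; near=> y => y0; apply: dG.
- exact: cvg_within_filter (cf 0).
Unshelve. all: by end_near. Qed.

End Primitive.

Section ParametricPrimitive.
Context {R : realType}.
Implicit Types (f g : R -> R -> R).

(** Compactness of [[-K, K]] turns joint continuity into uniformity in [a], which passes to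
    primitives in the second variable. *)
Lemma continuous2_uniform f (w0 K e : R) : continuous2 f -> 0 < e ->
  \forall w \near w0, forall a, `|a| <= K -> `|f w a - f w0 a| <= e.
Proof.
move=> cf e0; have /compact_near_coveringP : compact `[- K, K] by apply: segment_compact.
move=> /(_ _ (nbhs w0) (fun w a => `|f w a - f w0 a| <= e)) cov.
have {cov} : \forall w \near w0, `[-K, K] `<=` (fun a => `|f w a - f w0 a| <= e).
  apply: cov => a _.
  have e2 : 0 < e / 2 by rewrite divr_gt0.
  have /cvgrPdist_le/(_ _ e2) := cf (w0, a) => /=.
  case=> -[P Q] [/= Pw Qa] PQ.
  exists (Q, P) => //= -[b w] [/= Qb Pw0].
  have H1 := PQ (w, b) (conj Pw0 Qb); have H2 := PQ (w0, b) (conj (nbhs_singleton Pw) Qb).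
  rewrite /= in H1 H2; rewrite distrC.
  rewrite -(subrKA (f w0 a)) (le_trans (ler_normD _ _))// (splitr e) lerD//.
  by rewrite distrC.
by apply: filterS => w H a aK; apply: H; rewrite /= in_itv/= -ler_norml.
Qed.

Definition primitive2 f G := forall w, G w 0 = 0 /\ forall a : R, is_derive a 1 (G w) (f w a).

Lemma exists_primitive2 f : continuous2 f -> exists G, primitive2 f G.
Proof.
move=> cf; have [G GP] : {G : R -> R -> R & forall w, G w 0 = 0 /\
    forall a : R, is_derive a 1 (G w) (f w a)}.
  apply: (@choice _ _ (fun w G => G 0 = 0 /\ forall a : R, is_derive a 1 G (f w a))).
  move=> w; apply: exists_primitive => a.
  exact: (continuous_comp_two (cf _) (cvg_cst _) (@cvg_id _ _)).
by exists G.
Qed.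

Lemma primitive2_continuous f G : continuous2 f -> primitive2 f G -> continuous2 G.
Proof.
move=> cf GP [w0 a0]; apply/cvgrPdist_lt => e e0 /=.
pose K := `|a0| + 1.
have K0 : 0 < K by rewrite ltr_wpDl.
have e2 : 0 < e / 2 by rewrite divr_gt0.
have eK : 0 < e / 2 / (K + 1) by rewrite divr_gt0// addr_gt0.
have uw := continuous2_uniform w0 K cf eK.
have ca : {for a0, continuous (G w0)}.
  exact: is_derive_continuous ((GP w0).2 a0).
have aK : \forall a \near a0, `|a| <= K.
  apply: filterS (nbhsx_ballx a0 1 ltr01) => a; rewrite -ball_normE/= distrC.
  move=> /ltW ha; rewrite /K -lerBlDl.
  exact: le_trans (lerB_dist _ _) ha.
move/cvgrPdist_lt: ca => /(_ _ e2) ca.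
exists ((fun w => forall a, `|a| <= K -> `|f w a - f w0 a| <= e / 2 / (K + 1)),
        (fun a => `|a| <= K /\ `|G w0 a0 - G w0 a| < e / 2)) => //=.
  by split => //; apply: filterI.
move=> [w a] [/= Hw [Ha1 Ha2]].
rewrite -(subrKA (G w0 a)) (le_lt_trans (ler_normD _ _))// (splitr e) ltr_leD//.
have H := @bounded_derive_le _ (fun b => G w0 b - G w b) (fun b => f w0 b - f w b) K
   (e / 2 / (K + 1)) a.
apply: (@le_trans _ _ (e / 2 / (K + 1) * `|a|)).
  apply: H => //.
  - move=> z _; have ? := (GP w0).2 z; have ? := (GP w).2 z.
    exact: is_deriveB.
  - by move=> z zK; rewrite distrC; apply: Hw.
  - by rewrite (GP w0).1 (GP w).1 subrr.
rewrite -[leRHS]mulr1 -mulrA ler_wpM2l ?(ltW e2)//.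
rewrite mulrC ler_pdivrMr ?mul1r; last by rewrite addr_gt0.
by rewrite (le_trans Ha1)// lerDl.
Qed.

(* Apply the mean value theorem in [a] to the difference quotient in [w] minus [G1 w]. *)
Lemma C1two_primitive2 f f1 G G1 : continuous2 f -> continuous2 f1 ->
  (forall w a : R, is_derive w 1 (f^~ a) (f1 w a)) ->
  primitive2 f G -> primitive2 f1 G1 -> C1two G G1 f.
Proof.
move=> cf cf1 df GP G1P; split => //; last first.
- exact: primitive2_continuous G1P.
- by move=> w a; apply: (GP w).2.
move=> w a; pose K := `|a| + 1.
have K0 : 0 < K by rewrite ltr_wpDl.
pose s v := if v == w then G1 w a else (G v a - G w a) / (v - w).
apply: (@near_is_derive_slope _ _ _ _ s); last by rewrite /s eqxx.
  near=> v; rewrite /s; case: eqP => [->|/eqP yx]; first by rewrite !subrr mulr0.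
  by rewrite divfK// subr_eq0.
apply/cvgrPdist_le => e e0; rewrite /s eqxx.
have eK : 0 < e / (K + 1) by rewrite divr_gt0// addr_gt0.
have /nbhs_ballP[d /= d0 dP] := continuous2_uniform w K cf1 eK.
suff : \forall v \near w, `|G1 w a - s v| <= e by [].
near=> v; rewrite /s; have [_|vw] := eqVneq v w; first by rewrite subrr normr0 ltW.
have vd : ball w d v by near: v; apply: nbhsx_ballx.
have slope b : `|b| <= K -> `|(f v b - f w b) / (v - w) - f1 w b| <= e / (K + 1).
  move=> bK.
  have [z zvw ->] := MVT_between (fun z _ => df z b)
    (is_derive_continuous (df w b)) (is_derive_continuous (df v b)).
  rewrite mulfK ?subr_eq0//; apply: dP => //.
  move: vd; rewrite -!ball_normE/= ![`|w - _|]distrC.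
  exact: le_lt_trans (between_dist zvw).
rewrite distrC.
have := @bounded_derive_le _ (fun b => (v - w)^-1 *: (G v b - G w b) - G1 w b)
  (fun b => (v - w)^-1 *: (f v b - f w b) - f1 w b) K (e / (K + 1)) a.
rewrite [(_ - G w a) / _]mulrC => H.
apply: (@le_trans _ _ (e / (K + 1) * `|a|)); first apply: H.
- move=> z _; have ? := (GP v).2 z; have ? := (GP w).2 z; have ? := (G1P w).2 z.
  exact: is_deriveB.
- by move=> z zK; rewrite /GRing.scale/= mulrC; apply: slope.
- by rewrite (GP w).1 (GP v).1 (G1P w).1 subrr scaler0 subrr.
- by rewrite /K lerDl.
rewrite -[leRHS]mulr1 -mulrA ler_wpM2l ?(ltW e0)//.
rewrite mulrC ler_pdivrMr ?mul1r; last by rewrite addr_gt0.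
by rewrite /K -addrA lerDl.
Unshelve. all: by end_near. Qed.

End ParametricPrimitive.

(** * Functions of class C2 on open sets *)

Section Gradient.
Context {R : realType} {n : nat}.
Implicit Types (f g : 'rV[R]_n -> R) (D : set 'rV[R]_n).

Lemma is_derive_line f x v (d : R) :
  is_derive x v f d <-> is_derive (0 : R) 1 (fun h => f (h *: v + x)) d.
Proof.
have E : derive f x v = derive (fun h : R => f (h *: v + x)) 0 1.
  rewrite /derive; set g1 := fun h => h^-1 *: _; set g2 := fun h => h^-1 *: _.
  suff -> : g1 = g2 by [].
  apply/funext => h; rewrite /g1 /g2 /=.
  by rewrite addr0 scale0r add0r [_%:A]mulr1.
split=> -[d1 d2]; split.
- by move/derivable1P : d1.
- by rewrite -E.
- by apply/derivable1P.
- by rewrite E.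
Qed.

Lemma continuous_line (x v : 'rV[R]_n) : continuous (fun h : R => h *: v + x).
Proof. by move=> h; apply: cvgD; [apply: scalel_continuous|apply: cvg_cst]. Qed.

(** The partial derivatives are named functions, so that sum, product and chain rules compute them;
    [D] is either the whole space or the space off the origin. Continuity of [f] is carried along
    because the calculus runs along coordinate lines only. *)
Definition grad D f (df : 'I_n -> 'rV[R]_n -> R) := forall x, D x ->
  {for x, continuous f} /\
  forall i, is_derive x (evec i) f (df i x) /\ {for x, continuous (df i)}.

Definition C1on D f := exists df, grad D f df.

Definition C2on D f := exists2 df, grad D f df & forall i, C1on D (df i).

Lemma C2on_C1on D f : C2on D f -> C1on D f.
Proof. by move=> [df ? _]; exists df. Qed.

Lemma gradW D D' f df : D' `<=` D -> grad D f df -> grad D' f df.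
Proof. by move=> DD' fdf x /DD' /fdf. Qed.

Lemma C1onW D D' f : D' `<=` D -> C1on D f -> C1on D' f.
Proof. by move=> DD' [df ?]; exists df; apply: gradW DD' _. Qed.

Lemma C2onW D D' f : D' `<=` D -> C2on D f -> C2on D' f.
Proof.
move=> DD' [df fdf df1]; exists df; first exact: gradW DD' _.
by move=> i; apply: C1onW DD' _.
Qed.

Lemma grad_cst D (c : R) : grad D (fun=> c) (fun _ _ => 0).
Proof.
move=> x _; split=> [|i]; first exact: cst_continuous.
by split; [exact: is_derive_cst|exact: cst_continuous].
Qed.

Lemma C2on_cst D (c : R) : C2on D (fun=> c).
Proof.
exists (fun _ _ => 0); first exact: grad_cst.
by move=> i; exists (fun _ _ => 0); apply: grad_cst.
Qed.

Lemma gradD D f g df dg : grad D f df -> grad D g dg ->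
  grad D (fun x => f x + g x) (fun i x => df i x + dg i x).
Proof.
move=> Hf Hg x Dx; have [cf Hf'] := Hf x Dx; have [cg Hg'] := Hg x Dx.
split=> [|i]; first exact: (cvgD cf cg).
have [? cdf] := Hf' i; have [? cdg] := Hg' i.
by split; [exact: is_deriveD|exact: (cvgD cdf cdg)].
Qed.

Lemma gradM D f g df dg : grad D f df -> grad D g dg ->
  grad D (fun x => f x * g x) (fun i x => df i x * g x + f x * dg i x).
Proof.
move=> Hf Hg x Dx; have [cf Hf'] := Hf x Dx; have [cg Hg'] := Hg x Dx.
split=> [|i]; first exact: (cvgM cf cg).
have [? cdf] := Hf' i; have [? cdg] := Hg' i.
split; last exact: (cvgD (cvgM cdf cg) (cvgM cf cdg)).
by apply: is_derive_eq; rewrite /GRing.scale/= addrC mulrC.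
Qed.

Lemma C1onD D f g : C1on D f -> C1on D g -> C1on D (fun x => f x + g x).
Proof. by move=> [df Hf] [dg Hg]; eexists; apply: gradD Hf Hg. Qed.

Lemma C1onM D f g : C1on D f -> C1on D g -> C1on D (fun x => f x * g x).
Proof. by move=> [df Hf] [dg Hg]; eexists; apply: gradM Hf Hg. Qed.

Lemma C2onD D f g : C2on D f -> C2on D g -> C2on D (fun x => f x + g x).
Proof.
move=> [df Hf Hdf] [dg Hg Hdg]; eexists; first exact: gradD Hf Hg.
by move=> i; apply: C1onD.
Qed.

Lemma C2onM D f g : C2on D f -> C2on D g -> C2on D (fun x => f x * g x).
Proof.
move=> [df Hf Hdf] [dg Hg Hdg]; eexists; first exact: gradM Hf Hg.
move=> i; apply: C1onD; apply: C1onM => //.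
- by exists dg.
- by exists df.
Qed.

Lemma C2onN D f : C2on D f -> C2on D (fun x => - f x).
Proof.
move=> Cf; have := C2onM (C2on_cst D (-1)) Cf.
by under eq_fun do rewrite mulN1r.
Qed.

Lemma grad_comp D f df (phi dphi : R -> R) : grad D f df ->
  (forall x, D x -> is_derive (f x) 1 phi (dphi (f x)) /\ {for f x, continuous dphi}) ->
  grad D (fun x => phi (f x)) (fun i x => dphi (f x) * df i x).
Proof.
move=> Hf Hphi x Dx; have [cf Hf'] := Hf x Dx; have [dp cdp] := Hphi x Dx.
split=> [|i]; first exact: (continuous_comp cf (is_derive_continuous dp)).
have [/is_derive_line dfi cdf] := Hf' i.
split; last exact: (cvgM (continuous_comp cf cdp) cdf).
apply/is_derive_line.
have dp' : is_derive (f (0 *: evec i + x)) 1 phi (dphi (f x)) by rewrite scale0r add0r.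
exact: is_derive1_comp dp' dfi.
Qed.

Lemma C2on_comp D f (phi dphi ddphi : R -> R) : C2on D f ->
  (forall x, D x -> [/\ is_derive (f x) 1 phi (dphi (f x)),
     is_derive (f x) 1 dphi (ddphi (f x)) & {for f x, continuous ddphi}]) ->
  C2on D (fun x => phi (f x)).
Proof.
move=> [df Hf Hdf] Hphi; eexists.
  apply: grad_comp Hf _ => x /Hphi[h1 h2 _].
  by split; [exact: h1|exact: is_derive_continuous h2].
move=> i /=; apply: C1onM (Hdf i).
exists (fun i x => ddphi (f x) * df i x); apply: grad_comp => // x /Hphi[_ h2 h3].
by split; [exact: h2|].
Qed.

Lemma grad_comp2 D E E1 E2 f g df dg : C1two E E1 E2 -> grad D f df -> grad D g dg ->
  grad D (fun x => E (f x) (g x))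
    (fun i x => E1 (f x) (g x) * df i x + E2 (f x) (g x) * dg i x).
Proof.
move=> CE Hf Hg x Dx; have [cf Hf'] := Hf x Dx; have [cg Hg'] := Hg x Dx.
have cE := C1two_continuous2 CE; have [_ _ cE1 cE2] := CE.
split=> [|i]; first exact: (continuous_comp_two (cE _) cf cg).
have [/is_derive_line dfi cdf] := Hf' i; have [/is_derive_line dgi cdg] := Hg' i.
split; last first.
  exact: (cvgD (cvgM (continuous_comp_two (cE1 _) cf cg) cdf)
               (cvgM (continuous_comp_two (cE2 _) cf cg) cdg)).
apply/is_derive_line.
have := is_derive_comp2 CE dfi dgi; by rewrite scale0r add0r.
Qed.

Lemma C1on_comp2 D E E1 E2 f g : C1two E E1 E2 -> C1on D f -> C1on D g ->
  C1on D (fun x => E (f x) (g x)).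
Proof. by move=> CE [df Hf] [dg Hg]; eexists; apply: grad_comp2 CE Hf Hg. Qed.

(** As [E2] is positive everywhere, [continuous_implicit] gives continuity of [th] at every point;
    then [is_derive_implicit] applies on each coordinate line. *)
Lemma grad_implicit E E1 E2 (W b th : 'rV[R]_n -> R) dW db : C1two E E1 E2 ->
  (forall u v, 0 < E2 u v) -> (forall x, E (W x) (th x) = b x) ->
  grad setT W dW -> grad setT b db ->
  grad setT th (fun i x => (db i x - E1 (W x) (th x) * dW i x) / E2 (W x) (th x)).
Proof.
move=> CE E2p Eb HW Hb.
have cE := C1two_continuous2 CE; have [d1 d2 cE1 cE2] := CE.
have incE u : {homo E u : x y / x < y}.
  move=> x y xy; have [z _] := MVT_between (fun z _ => d2 u z)
    (is_derive_continuous (d2 u x)) (is_derive_continuous (d2 u y)).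
  by move=> H; rewrite -subr_gt0 H mulr_gt0// subr_gt0.
have cth x : {for x, continuous th}.
  have [cW _] := HW x I; have [cb _] := Hb x I.
  exact: continuous_implicit cE incE Eb cW cb.
move=> x _; have [cW HW'] := HW x I; have [cb Hb'] := Hb x I.
split=> [|i]; first exact: cth.
have [/is_derive_line dWi cdW] := HW' i; have [/is_derive_line dbi cdb] := Hb' i.
split; last first.
  have c1 : {for x, continuous (fun y => E1 (W y) (th y))}.
    exact: (continuous_comp_two (cE1 _) cW (cth x)).
  have c2 : {for x, continuous (fun y => E2 (W y) (th y))}.
    exact: (continuous_comp_two (cE2 _) cW (cth x)).
  apply: (cvgM (cvgB cdb (cvgM c1 cdW)) (cvgV _ c2)).
  by rewrite gt_eqF.
apply/is_derive_line.
have := is_derive_implicit (th := fun h : R => th (h *: evec i + x)) CE _ _ _ dWi dbi.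
rewrite scale0r add0r; apply.
- by rewrite gt_eqF.
- exact: (continuous_comp (@continuous_line x (evec i) 0) (cth _)).
- by move=> h; apply: Eb.
Qed.

Lemma grad_open_ext D f g df : open D -> {in D, f =1 g} -> grad D f df -> grad D g df.
Proof.
move=> oD fg Hf x Dx; have [cf Hf'] := Hf x Dx.
have nfg : \forall y \near x, f y = g y.
  by apply: filterS (open_nbhs_nbhs (conj oD Dx)) => y Dy; apply: fg; rewrite inE.
split=> [|i].
  rewrite /prop_for /continuous_at -(fg x) ?inE//.
  exact: cvg_trans (near_eq_cvg nfg) cf.
have [dfi cdf] := Hf' i; split => //.
exact: near_eq_is_derive nfg dfi.
Qed.

Lemma grad_ext_df D f df df' : open D -> (forall i x, D x -> df i x = df' i x) ->
  grad D f df -> grad D f df'.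
Proof.
move=> oD E Hf x Dx; have [cf Hf'] := Hf x Dx; split => // i.
have [dfi cdf] := Hf' i; split; first by rewrite -E.
have nE : \forall y \near x, df i y = df' i y.
  by apply: filterS (open_nbhs_nbhs (conj oD Dx)) => y Dy; apply: E.
by rewrite /prop_for /continuous_at -E//; apply: cvg_trans (near_eq_cvg nE) cdf.
Qed.

Lemma grad_coord D (k : 'I_n) : grad D (fun x => x 0 k) (fun i _ => (k == i)%:R).
Proof.
move=> x _; split=> [|i]; first exact: coord_continuous.
split; last exact: cst_continuous.
apply/is_derive_line; under eq_fun do rewrite !mxE/=.
by apply: is_derive_eq; rewrite addr0 /GRing.scale/= mulr0 add0r mulr1.
Qed.

Lemma C2on_coord D (k : 'I_n) : C2on D (fun x => x 0 k).
Proof.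
exists (fun i _ => (k == i)%:R); first exact: grad_coord.
by move=> i; apply/C2on_C1on/C2on_cst.
Qed.

Lemma C2P f : C2 f <-> C2on setT f.
Proof.
split.
- move=> [cf Hf]; exists (fun i => pd i f).
    move=> x _; split=> [|i]; first exact: cf.
    by have [h1 [h2 _]] := Hf i i; split; [exact: derivableP|exact: h2].
  move=> i; exists (fun j => pd j (pd i f)) => x _.
  split=> [|j]; first by have [_ [h2 _]] := Hf i i; apply: h2.
  by have [_ [_ [h3 h4]]] := Hf i j; split; [exact: derivableP|exact: h4].
- move=> [df Hf Hdf].
  have pdE i : pd i f = df i.
    by apply/funext => x; have [_ /(_ i)[dfi _]] := Hf x I; rewrite /pd derive_val.
  split=> [x|i j]; first exact: (Hf x I).1.
  have [ddf Hddf] := Hdf i.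
  have ppdE : pd j (pd i f) = ddf j.
    apply/funext => x; have [_ /(_ j)[dfi _]] := Hddf x I.
    by rewrite /pd in pdE *; rewrite pdE derive_val.
  split; first by move=> x; have [_ /(_ i)[]] := Hf x I.
  rewrite ppdE pdE; split; first by move=> x; have [_ /(_ i)[]] := Hf x I.
  by split=> x; have [_ /(_ j)[]] := Hddf x I.
Qed.

Lemma derive_grad D f df x i : grad D f df -> D x -> pd i f x = df i x.
Proof. by move=> Hf Dx; have [_ /(_ i)[dfi _]] := Hf x Dx; rewrite /pd derive_val. Qed.

End Gradient.

(** * The scalar oscillator *)

Section AbsolutePower.
Context {R : realType}.

Lemma continuous_abs_powR (r : R) : 0 < r -> continuous (fun x : R => `|x| `^ r).
Proof.
move=> r0 x; have [->|x0] := eqVneq x 0.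
  apply/cvgrPdist_lt => e e0; rewrite normr0 powR0 ?gt_eqF//.
  have d0 : 0 < e `^ r^-1 by rewrite powR_gt0.
  apply: filterS (nbhsx_ballx (0 : R) _ d0) => y; rewrite -ball_normE/= sub0r normrN => yd.
  rewrite sub0r normrN ger0_norm ?powR_ge0//.
  have -> : e = (e `^ r^-1) `^ r by rewrite -powRrM mulVf ?gt_eqF// powRr1// ltW.
  by apply: gt0_ltr_powR => //; rewrite nnegrE ?powR_ge0.
have nx0 : 0 < `|x| by rewrite normr_gt0.
have c1 := is_derive_continuous (is_derive1_powR r nx0).
exact: (continuous_comp (@norm_continuous _ _ x) c1).
Qed.

Lemma abs_powR2 (r x : R) : 0 < r -> `|x| `^ (r + 2) = `|x| `^ r * x * x.
Proof.
move=> r0; have [->|x0] := eqVneq x 0.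
  by rewrite mulr0 normr0 powR0// gt_eqF// addr_gt0.
rewrite powRD; last by rewrite normr_eq0 x0 implybT.
by rewrite powR_mulrn// real_normK ?num_real// expr2 mulrA.
Qed.

(** Used with [r = p - 1] for the potential energy. At [0] the difference quotient is |y|^r y,
    continuous for every [r > 0]. *)
Lemma is_derive_abs_powR (r x : R) : 0 < r ->
  is_derive x 1 (fun x : R => `|x| `^ (r + 2)) ((r + 2) * (`|x| `^ r * x)).
Proof.
move=> r0; have r2 : 0 < r + 2 by rewrite addr_gt0.
have [->|x0] := eqVneq x 0.
  rewrite !mulr0; apply: (@near_is_derive_slope _ _ _ _ (fun y => `|y| `^ r * y)).
  - near=> y; rewrite normr0 powR0 ?gt_eqF// !subr0; exact: abs_powR2.
  - by apply: cvgM; [exact: continuous_abs_powR|exact: cvg_id].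
  - by rewrite mulr0.
have pE (y : R) : 0 < y -> y `^ (r + 2 - 1) = y `^ r * y.
  move=> y0; rewrite -{3}(@powRr1 _ y) ?ltW// -powRD; last by rewrite implybE (gt_eqF y0) orbT.
  by congr (_ `^ _); lra.
move: x0; rewrite neq_lt => /orP[] x0.
- have nx0 : 0 < - x by rewrite oppr_gt0.
  apply: (@near_eq_is_derive _ _ _ ((fun y : R => y `^ (r + 2)) \o -%R)).
    by near=> y; rewrite /= ltr0_norm//; near: y; apply: lt_nbhsl.
  have ? := is_derive1_powR (r + 2) nx0; have ? : is_derive x 1 (-%R) (-1 : R).
    exact: is_deriveNid.
  apply: is_derive_eq; rewrite ltr0_norm// pE//; ring.
- apply: (@near_eq_is_derive _ _ _ (fun y : R => y `^ (r + 2))).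
    by near=> y; rewrite /= gtr0_norm//; near: y; apply: lt_nbhsr.
  have ? := is_derive1_powR (r + 2) x0.
  by apply: is_derive_eq; rewrite gtr0_norm// pE.
Unshelve. all: by end_near. Qed.

End AbsolutePower.

(** * The energy quotient [kappa] *)

Section Kappa.
Context {R : realType} (p : R) (p1 : 1 < p).

Let a0 : R := (p + 1) / 2.

Let a01 : 1 < a0.
Proof. by rewrite /a0 ltr_pdivlMr// mul1r ltrD2r. Qed.

(* the value at [cos th = 0] is the limit of the quotient *)
Definition kappa (th : R) : R :=
  if cos th == 0 then 1 else (1 - `|sin th| `^ (p + 1)) / ((p + 1) / 2 * cos th ^+ 2).

Let sin_powE th : `|sin th| `^ (p + 1) = (sin th ^+ 2) `^ a0.
Proof.
rewrite -(real_normK (num_real (sin th))) -powR_mulrn// -powRrM.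
by congr (_ `^ _); rewrite /a0; field.
Qed.

Lemma cos2_kap th : cos th ^+ 2 * kappa th = (1 - `|sin th| `^ (p + 1)) / ((p + 1) / 2).
Proof.
rewrite /kappa; have [c0|c0] := eqVneq (cos th) 0.
  by rewrite sin_powE sin2cos2 c0 expr0n/= subr0 powR1 subrr !mul0r.
rewrite -/a0; field; rewrite c0/= gt_eqF//; exact: lt_trans a01.
Qed.

(** With v = sin^2 th, off the zeros of [cos], [kappa] is the mean slope of v^a0 on [v, 1] divided
    by [a0], hence equals z^(a0 - 1) for some z in [v, 1]. The resulting lower bound tends to [1]
    where [cos] vanishes, which gives continuity there. *)
Let kap_slope th : kappa th <= 1 /\ (sin th ^+ 2) `^ (a0 - 1) <= kappa th.
Proof.
have a00 : 0 < a0 by apply: lt_trans a01.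
rewrite /kappa; have [c0|c0] := eqVneq (cos th) 0.
  by rewrite lexx sin2cos2 c0 expr0n/= subr0 powR1.
rewrite sin_powE sin2cos2; have cc : 0 < cos th ^+ 2 by rewrite exprn_even_gt0.
set v := 1 - cos th ^+ 2.
have v0 : 0 <= v by rewrite /v -sin2cos2 sqr_ge0.
have v1 : v < 1 by rewrite /v ltrBlDr ltrDl.
have c2E : cos th ^+ 2 = 1 - v by rewrite /v opprB addrC subrK.
rewrite c2E -/a0.
have dz z : Num.min v 1 < z < Num.max v 1 ->
    is_derive z 1 (fun x : R => `|x| `^ a0) (a0 * z `^ (a0 - 1)).
  rewrite (min_l (ltW v1)) (max_r (ltW v1)) => /andP[z0 _]; have {}z0 := le_lt_trans v0 z0.
  apply: near_eq_is_derive (is_derive1_powR a0 z0).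
  by near=> y; rewrite /= gtr0_norm//; near: y; apply: lt_nbhsr.
have [z] := MVT_between dz (continuous_abs_powR a00 (x := v)) (continuous_abs_powR a00 (x := 1)).
rewrite (min_l (ltW v1)) (max_r (ltW v1)) => /andP[vz z1]; rewrite normr1 powR1 ger0_norm// => ->.
have -> : a0 * z `^ (a0 - 1) * (1 - v) / (a0 * (1 - v)) = z `^ (a0 - 1).
  apply: (canLR (mulfK _)); last by rewrite mulrA [_ * a0]mulrC.
  by rewrite mulf_neq0 ?gt_eqF// subr_gt0.
have a1 : 0 <= a0 - 1 by rewrite subr_ge0 ltW.
have z0 := le_trans v0 vz.
split; last by apply: ge0_ler_powR; rewrite ?nnegrE.
have e1 : (1 : R) `^ (a0 - 1) = 1 by rewrite powR1.
rewrite -[leRHS]e1; by apply: ge0_ler_powR; rewrite ?nnegrE.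
Unshelve. all: by end_near. Qed.

Lemma kap_le1 th : kappa th <= 1. Proof. exact: (kap_slope th).1. Qed.

(** Since v^a0 <= v on [0, 1], the numerator is at least cos^2 th. Unlike the bound of [kap_slope],
    this one does not degenerate where [sin th = 0]. *)
Lemma kap_ge th : ((p + 1) / 2)^-1 <= kappa th.
Proof.
rewrite /kappa; have [c0|c0] := eqVneq (cos th) 0.
  by rewrite invf_le1 ?ltW//; apply: lt_trans a01.
rewrite sin_powE sin2cos2; have cc : 0 < cos th ^+ 2 by rewrite exprn_even_gt0.
have a00 : 0 < a0 by apply: lt_trans a01.
have ac0 : 0 < a0 * cos th ^+ 2 by rewrite mulr_gt0.
rewrite -/a0 (ler_pdivlMr _ _ ac0) mulrA mulVf ?gt_eqF// mul1r.
rewrite lerBrDr -lerBrDl -sin2cos2.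
have := sqr_ge0 (sin th); rewrite le_eqVlt => /predU1P[<-|s0].
  by rewrite powR0// gt_eqF//; apply: lt_trans a01.
by apply: ge1r_powR; [rewrite s0 sin2cos2 lerBlDr lerDl ltW|apply: ltW].
Qed.

Lemma kap_gt0 th : 0 < kappa th.
Proof. by apply: lt_le_trans (kap_ge th); rewrite invr_gt0; apply: lt_trans a01. Qed.

Lemma continuous_kap : continuous kappa.
Proof.
move=> th; have [c0|c0] := eqVneq (cos th) 0; last first.
  have nE : \forall t \near th,
      (1 - `|sin t| `^ (p + 1)) / ((p + 1) / 2 * cos t ^+ 2) = kappa t.
    have : \forall t \near th, cos t != 0 by exact: (cvgr_neq0 _ (@continuous_cos R th) c0).
    by apply: filterS => t; rewrite /kappa => /negbTE->.
  rewrite /continuous_at.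
  have -> : kappa th = (1 - `|sin th| `^ (p + 1)) / ((p + 1) / 2 * cos th ^+ 2).
    by rewrite /kappa (negbTE c0).
  apply: cvg_trans (near_eq_cvg nE) _.
  have cs : `|sin t| `^ (p + 1) @[t --> th] --> `|sin th| `^ (p + 1).
    have p10 : 0 < p + 1 by rewrite addr_gt0// (lt_trans ltr01).
    exact: (continuous_comp (@continuous_sin _ th) (continuous_abs_powR p10 (x := sin th))).
  have cc := @continuous_cos R th.
  apply: cvgM; first by apply: cvgB => //; exact: cvg_cst.
  apply: cvgV; first by rewrite mulf_neq0 ?expf_neq0// gt_eqF//; apply: lt_trans a01.
  by apply: cvgM; [exact: cvg_cst|apply: cvgM].
rewrite /continuous_at {2}/kappa c0 eqxx.
apply: (@squeeze_cvgr _ _ _ _ (fun t => `|sin t ^+ 2| `^ (a0 - 1)) (fun=> 1)).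
- near=> t; rewrite ger0_norm ?sqr_ge0//; apply/andP.
  by have [? ?] := kap_slope t.
- have a10 : 0 < a0 - 1 by rewrite subr_gt0.
  have e1 : `|sin th ^+ 2| `^ (a0 - 1) = 1.
    by rewrite sin2cos2 c0 expr0n/= subr0 normr1 powR1.
  rewrite -[X in _ --> X]e1.
  have cs : {for th, continuous (fun t : R => sin t ^+ 2)}.
    exact: (cvgM (@continuous_sin R th) (@continuous_sin R th)).
  exact: (continuous_comp cs (continuous_abs_powR a10 (x := sin th ^+ 2))).
- exact: cvg_cst.
Unshelve. all: by end_near. Qed.

Lemma kapD2pi th : kappa (th + 2 * pi) = kappa th.
Proof. by rewrite /kappa mulr_natl sinD2pi cosD2pi. Qed.

End Kappa.

(** * The integrand of time over the phase *)

Section Integrand.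
Context {R : realType}.
Implicit Types (w k : R).

(* With [kappa] in place of [k], the energy identity of [z'' + z + `|z| `^ (p - 1) * z = 0]
   for [z = c * sin th] and [c `^ (p - 1) = expR w - 1] reads [th' ^+ 2 = aa w (kappa th)].
   The exponential makes [aa] positive for every real [w]. *)
Definition aa w k : R := 1 + (expR w - 1) * k.
Definition rr w k : R := (Num.sqrt (aa w k))^-1.
Definition qq w k : R := (1 + rr w k)^-1.

(* [1 - (expR w - 1) * mm w k = rr w k], with [mm] smooth up to [w = 0] *)
Definition mm w k : R := k * rr w k ^+ 2 * qq w k.
(** [mm1] and [mm2] are the first two [w]-derivatives of [mm], reduced to polynomials in [k],
    [expR w], [rr] and [qq] so that continuity is read off factor by factor. Here [k] is held fixed,
    as it will be replaced by [kappa], known only to be continuous. *)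
Definition mm1 w k : R :=
  - 2^-1 * k ^+ 2 * expR w * rr w k ^+ 4 * (2 + rr w k) * qq w k ^+ 2.
Definition mm2 w k : R := mm1 w k +
  4^-1 * k ^+ 3 * expR w ^+ 2 * rr w k ^+ 3 *
  ((8 * rr w k ^+ 3 + 5 * rr w k ^+ 4) * qq w k ^+ 2
   - 2 * rr w k ^+ 4 * (2 + rr w k) * qq w k ^+ 3).

Lemma aa_gt0 w k : 0 < k <= 1 -> 0 < aa w k.
Proof.
move=> /andP[k0 k1]; have -> : aa w k = (1 - k) + k * expR w by rewrite /aa; ring.
by rewrite ltr_wpDl ?subr_ge0// mulr_gt0// expR_gt0.
Qed.

Lemma rr_gt0 w k : 0 < k <= 1 -> 0 < rr w k.
Proof. by move=> /(aa_gt0 w) a0; rewrite invr_gt0 sqrtr_gt0. Qed.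

Lemma aa_rr w k : 0 < k <= 1 -> aa w k * rr w k ^+ 2 = 1.
Proof.
move=> /(aa_gt0 w) a0; rewrite /rr exprVn sqr_sqrtr ?ltW// mulfV// gt_eqF//.
Qed.

(** From [aa * rr ^+ 2 = 1] follows (aa - 1) rr^2 = 1 - rr^2 = (1 - rr)(1 + rr), and [qq] divides
    out the last factor. *)
Lemma rr_mm w k : 0 < k <= 1 -> 1 - (expR w - 1) * mm w k = rr w k.
Proof.
move=> k01; have r0 := rr_gt0 w k01; have ar := aa_rr w k01.
have q1 : (1 + rr w k) * qq w k = 1 by rewrite mulfV// gt_eqF// addr_gt0.
have -> : (expR w - 1) * mm w k = (aa w k * rr w k ^+ 2 - rr w k ^+ 2) * qq w k.
  by rewrite /mm /aa; ring.
have -> : (aa w k * rr w k ^+ 2 - rr w k ^+ 2) * qq w k =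
    (1 - rr w k) * ((1 + rr w k) * qq w k) by rewrite ar; ring.
by rewrite q1; ring.
Qed.

Lemma is_derive_rr w k : 0 < k <= 1 ->
  is_derive w 1 (rr^~ k) (- 2^-1 * k * expR w * rr w k ^+ 3).
Proof.
move=> k01; have a0 := aa_gt0 w k01; have s0 : 0 < Num.sqrt (aa w k) by rewrite sqrtr_gt0.
have da : is_derive w 1 (aa^~ k) (k * expR w).
  rewrite /aa; apply: is_derive_eq; rewrite /GRing.scale/=; ring.
have ds := @is_derive1_comp R Num.sqrt (aa^~ k) w _ _ (is_derive1_sqrt a0) da.
have H := is_deriveV (f := Num.sqrt \o aa^~ k) (lt0r_neq0 s0) ds.
apply: (@is_derive_eq _ _ _ _ _ _ _ _ H).
rewrite /GRing.scale/= /rr; field; rewrite gt_eqF//.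
Qed.

Lemma is_derive_qq w k : 0 < k <= 1 ->
  is_derive w 1 (qq^~ k) (2^-1 * k * expR w * rr w k ^+ 3 * qq w k ^+ 2).
Proof.
move=> k01; have r0 := rr_gt0 w k01; have dr := is_derive_rr w k01.
have d1 : is_derive w 1 (fun w => 1 + rr w k) (- 2^-1 * k * expR w * rr w k ^+ 3).
  by have H := is_deriveD (is_derive_cst (1 : R) w (1 : R)) dr; rewrite add0r in H.
have n1 : 1 + rr w k != 0 by rewrite gt_eqF// addr_gt0.
have H := is_deriveV (f := fun w => 1 + rr w k) n1 d1; apply: (@is_derive_eq _ _ _ _ _ _ _ _ H).
rewrite /GRing.scale/= /qq; field; rewrite n1//.
Qed.

#[local] Typeclasses Opaque rr qq.

Lemma is_derive_mm w k : 0 < k <= 1 -> is_derive w 1 (mm^~ k) (mm1 w k).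
Proof.
move=> k01; have dr := is_derive_rr w k01; have dq := is_derive_qq w k01.
have r0 := rr_gt0 w k01.
have n1 : 1 + rr w k != 0 by rewrite gt_eqF// addr_gt0.
rewrite /mm; apply: is_derive_eq; rewrite /mm1 /GRing.scale/=.
rewrite /qq; field; rewrite n1//.
Qed.

Lemma is_derive_mm1 w k : 0 < k <= 1 -> is_derive w 1 (mm1^~ k) (mm2 w k).
Proof.
move=> k01; have dr := is_derive_rr w k01; have dq := is_derive_qq w k01.
have r0 := rr_gt0 w k01.
have n1 : 1 + rr w k != 0 by rewrite gt_eqF// addr_gt0.
rewrite /mm1; apply: is_derive_eq; rewrite /mm2 /mm1 /GRing.scale/=.
rewrite /qq; field; rewrite n1//.
Qed.

End Integrand.

Lemma continuous2_fst {R : realType} (f : R -> R) :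
  continuous f -> continuous2 (fun u _ => f u).
Proof.
by move=> cf z; apply: (@continuous_comp _ _ _ fst f z); [exact: cvg_fst|exact: cf].
Qed.

Lemma continuous2_snd {R : realType} (f : R -> R) :
  continuous f -> continuous2 (fun _ v => f v).
Proof.
by move=> cf z; apply: (@continuous_comp _ _ _ snd f z); [exact: cvg_snd|exact: cf].
Qed.

Section ContinuousTwo.
Context {R : realType}.
Implicit Types f g : R -> R -> R.

Lemma continuous2_cst (c : R) : continuous2 (fun _ _ : R => c).
Proof. by move=> z; exact: cvg_cst. Qed.

Lemma continuous2D f g : continuous2 f -> continuous2 g ->
  continuous2 (fun u v => f u v + g u v).
Proof. by move=> cf cg z; apply: cvgD; [exact: cf|exact: cg]. Qed.

Lemma continuous2M f g : continuous2 f -> continuous2 g ->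
  continuous2 (fun u v => f u v * g u v).
Proof. by move=> cf cg z; apply: cvgM; [exact: cf|exact: cg]. Qed.

Lemma continuous2N f : continuous2 f -> continuous2 (fun u v => - f u v).
Proof. by move=> cf z; apply: cvgN; exact: cf. Qed.

Lemma continuous2X f n : continuous2 f -> continuous2 (fun u v => f u v ^+ n).
Proof.
move=> cf; elim: n => [|n IH]; first exact: continuous2_cst.
have -> : (fun u v => f u v ^+ n.+1) = (fun u v => f u v * f u v ^+ n).
  by apply/funext => u; apply/funext => v; rewrite exprS.
exact: continuous2M.
Qed.

End ContinuousTwo.

#[local] Typeclasses Opaque mm mm1 mm2 rr qq.

(** * Time as a function of the phase, and the period *)

Section Phase.
Context {R : realType} (p : R) (p1 : 1 < p).

Local Notation kap := (kappa p).

Lemma kap01 (th : R) : 0 < kap th <= 1.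
Proof. by rewrite kap_gt0//= kap_le1. Qed.

Lemma continuous_kap2 : continuous2 (fun _ : R => kap).
Proof. exact: continuous2_snd (continuous_kap p1). Qed.

Lemma continuous_expR2 : continuous2 (fun (w _ : R) => expR w).
Proof. exact: continuous2_fst (@continuous_expR R). Qed.

Lemma continuous_rr : continuous2 (fun w th => rr w (kap th)).
Proof.
move=> [w th]; apply: cvgV.
  by rewrite gt_eqF// sqrtr_gt0 aa_gt0// kap01.
apply: continuous_comp; last exact: sqrt_continuous.
apply: cvgD; first exact: cvg_cst.
apply: cvgM.
  by apply: cvgB; [exact: continuous_expR2|exact: cvg_cst].
exact: continuous_kap2.
Qed.

Lemma continuous_qq : continuous2 (fun w th => qq w (kap th)).
Proof.
move=> [w th]; apply: cvgV.
  by rewrite gt_eqF// addr_gt0// rr_gt0// kap01.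
by apply: cvgD; [exact: cvg_cst|exact: continuous_rr].
Qed.

Ltac solve_continuous2 := lazymatch goal with
  | |- continuous2 (fun u v => @?f u v + @?g u v) =>
      apply: (@continuous2D _ f g); solve_continuous2
  | |- continuous2 (fun u v => @?f u v * @?g u v) =>
      apply: (@continuous2M _ f g); solve_continuous2
  | |- continuous2 (fun u v => - @?f u v) => apply: (@continuous2N _ f); solve_continuous2
  | |- continuous2 (fun u v => @?f u v ^+ ?n) => apply: (@continuous2X _ f n); solve_continuous2
  | |- continuous2 (fun _ _ => ?c) => apply: continuous2_cst
  | |- continuous2 (fun u v => expR u) => apply: continuous_expR2
  | |- continuous2 (fun u v => kappa _ v) => apply: continuous_kap2
  | |- continuous2 (fun u v => rr u _) => apply: continuous_rr
  | |- continuous2 (fun u v => qq u _) => apply: continuous_qq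
  | _ => idtac
  end.

Lemma continuous_mm : continuous2 (fun w th => mm w (kap th)).
Proof. rewrite /mm; solve_continuous2. Qed.

Lemma continuous_mm1 : continuous2 (fun w th => mm1 w (kap th)).
Proof. rewrite /mm1; solve_continuous2. Qed.

Lemma continuous_mm2 : continuous2 (fun w th => mm2 w (kap th)).
Proof. rewrite /mm2 /mm1; solve_continuous2. Qed.

Context (M M1 M2 : R -> R -> R).
Hypothesis MP : primitive2 (fun w th => mm w (kap th)) M.
Hypothesis M1P : primitive2 (fun w th => mm1 w (kap th)) M1.
Hypothesis M2P : primitive2 (fun w th => mm2 w (kap th)) M2.

Let CM : C1two M M1 (fun w th => mm w (kap th)).
Proof.
apply: C1two_primitive2 MP M1P; [exact: continuous_mm|exact: continuous_mm1|].
by move=> w a; apply: is_derive_mm; apply: kap01.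
Qed.

Let CM1 : C1two M1 M2 (fun w th => mm1 w (kap th)).
Proof.
apply: C1two_primitive2 M1P M2P; [exact: continuous_mm1|exact: continuous_mm2|].
by move=> w a; apply: is_derive_mm1; apply: kap01.
Qed.

(* [Tt w th] is the time at which the phase [th] is reached, the primitive of [rr w (kap th)];
   writing it through [M] shows that [2 * pi - Tt w (2 * pi)] has the factor [expR w - 1]. *)
Definition Tt w th : R := th - (expR w - 1) * M w th.
Definition Ttw w th : R := - (expR w * M w th + (expR w - 1) * M1 w th).
Definition Ttww w th : R :=
  - (expR w * M w th + 2 * (expR w * M1 w th) + (expR w - 1) * M2 w th).
Definition Ttwth w th : R := - 2^-1 * kap th * expR w * rr w (kap th) ^+ 3.

Let cM := C1two_continuous2 CM.
Let cM1 := C1two_continuous2 CM1.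
Let cM2 : continuous2 M2. Proof. by case: CM1. Qed.

Lemma C1two_Tt : C1two Tt Ttw (fun w th => rr w (kap th)).
Proof.
split.
- move=> w th; have [dM _ _ _] := CM; have ? := dM w th.
  by rewrite /Tt; apply: is_derive_eq; rewrite /Ttw /GRing.scale/=; ring.
- move=> w th; have [_ dM _ _] := CM; have ? := dM w th.
  rewrite /Tt; apply: is_derive_eq; rewrite -rr_mm ?kap01// /GRing.scale/=; ring.
- by rewrite /Ttw; solve_continuous2.
- exact: continuous_rr.
Qed.

Lemma C1two_Ttw : C1two Ttw Ttww Ttwth.
Proof.
split.
- move=> w th; have [dM _ _ _] := CM; have ? := dM w th.
  have [dM1 _ _ _] := CM1; have ? := dM1 w th.
  by rewrite /Ttw; apply: is_derive_eq; rewrite /Ttww /GRing.scale/=; ring.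
- move=> w th; have [_ dM _ _] := CM; have ? := dM w th.
  have [_ dM1 _ _] := CM1; have ? := dM1 w th.
  rewrite /Ttw; apply: is_derive_eq; rewrite /GRing.scale/=.
  have k01 := kap01 th.
  (* The mixed derivative is found by differentiating the identity [rr_mm] in [w]; uniqueness of
     derivatives identifies the two expressions without expanding [mm1]. *)
  have d1 : is_derive w 1 (fun w => 1 - (expR w - 1) * mm w (kap th)) (Ttwth w th).
    have -> : (fun w => 1 - (expR w - 1) * mm w (kap th)) = rr^~ (kap th).
      by apply/funext => v; rewrite rr_mm.
    exact: is_derive_rr.
  have ? := is_derive_mm w k01.
  rewrite -(derive_val (is_derive := d1)) {d1}.
  apply/esym/derive_val; apply: is_derive_eq; rewrite /GRing.scale/=; ring.
- by rewrite /Ttww; solve_continuous2.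
- by rewrite /Ttwth; solve_continuous2.
Qed.

Lemma Tt_MVT w (a b : R) : exists2 z, Num.min a b <= z <= Num.max a b &
  Tt w b - Tt w a = rr w (kap z) * (b - a).
Proof.
have [_ d2 _ _] := C1two_Tt.
exact: MVT_between (fun z _ => d2 w z)
  (is_derive_continuous (d2 w a)) (is_derive_continuous (d2 w b)).
Qed.

Lemma Tt0 w : Tt w 0 = 0. Proof. by rewrite /Tt (MP w).1 mulr0 subrr. Qed.

Lemma Tt_incr w : {homo Tt w : x y / x < y}.
Proof.
move=> x y xy; have [z _ E] := Tt_MVT w x y.
by rewrite -subr_gt0 E mulr_gt0 ?subr_gt0// rr_gt0 ?kap01.
Qed.

Lemma Tt_inj w : injective (Tt w).
Proof. by apply: inc_inj; apply: le_mono; apply: Tt_incr. Qed.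

(** For [0 < k <= 1] one has [aa w k <= 1 + expR w], so [rr] is at least the constant [c]. Time thus
    grows at least linearly in the phase, and the intermediate value theorem applies on
    [-|t|/c, |t|/c]. *)
Lemma Tt_surj w (t : R) : exists th, Tt w th = t.
Proof.
pose c := (Num.sqrt (1 + expR w))^-1.
have e0 := expR_gt0 w.
have c0 : 0 < c by rewrite invr_gt0 sqrtr_gt0 addr_gt0.
have cr z : c <= rr w (kap z).
  have /andP[k0 k1] := kap01 z; have a0 := aa_gt0 w (kap01 z).
  have s0 : 0 < 1 + expR w by rewrite addr_gt0.
  rewrite /c /rr lef_pV2 ?posrE ?sqrtr_gt0// ler_sqrt ?(ltW s0)//.
  by rewrite /aa lerD2l; nra.
pose K := `|t| / c.
have K0 : 0 <= K by rewrite divr_ge0// ltW.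
have tc x : 0 <= x -> c * x <= Tt w x.
  move=> x0; have [z _] := Tt_MVT w 0 x; rewrite Tt0 !subr0 => ->.
  by rewrite ler_wpM2r.
have tc' x : x <= 0 -> Tt w x <= c * x.
  move=> x0; have [z _] := Tt_MVT w 0 x; rewrite Tt0 !subr0 => ->.
  by rewrite ler_wnM2r.
have cK : c * K = `|t| by rewrite /K mulrC divfK// gt_eqF.
have KK : - K <= K by rewrite (le_trans _ K0)// oppr_le0.
have [_ d2 _ _] := C1two_Tt.
have cT : {within `[- K, K], continuous (Tt w)}.
  by apply: continuous_subspaceT => x; apply: is_derive_continuous (d2 w x).
have h1 : Tt w (- K) <= t.
  by rewrite (le_trans (tc' _ _)) ?oppr_le0// mulrN cK lerNl -normrN ler_norm.
have h2 : t <= Tt w K by rewrite (le_trans _ (tc _ K0))// cK ler_norm.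
have [|x _ <-] := @IVT _ (Tt w) _ _ t KK cT; last by exists x.
by rewrite ge_min h1 le_max h2 orbT.
Qed.

Definition Lp w := Tt w (2 * pi).

Let twopi0 : 0 < 2 * pi :> R. Proof. by rewrite mulr_gt0 ?pi_gt0. Qed.

Lemma TtD2pi w th : Tt w (th + 2 * pi) = Tt w th + Lp w.
Proof.
have [_ d2 _ _] := C1two_Tt.
pose f x := Tt w (x + 2 * pi) - Tt w x.
have df (x : R) : is_derive x 1 f 0.
  have ds : is_derive x 1 (fun x : R => x + 2 * pi) 1.
    by apply: is_derive_eq; rewrite addr0.
  have H := @is_derive1_comp R (Tt w) (fun x : R => x + 2 * pi) x _ _ (d2 w _) ds.
  have H2 := is_deriveB H (d2 w x).
  by apply: is_derive_eq; rewrite mulr1 kapD2pi subrr.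
have : f th = f 0 by apply: is_derive_0_is_cst.
by rewrite /f Tt0 add0r subr0 -/(Lp w) => <-; rewrite [RHS]addrC subrK.
Qed.

Lemma Lp0 : Lp 0 = 2 * pi.
Proof. by rewrite /Lp /Tt expR0 subrr mul0r subr0. Qed.

Lemma is_derive_Lp (w : R) : is_derive w 1 Lp (Ttw w (2 * pi)).
Proof. by have [d1 _ _ _] := C1two_Tt; apply: d1. Qed.

(** [Ttw w] vanishes at phase [0] and its phase derivative is negative: a larger [w] raises the
    speed at every phase. *)
Lemma Lp'_lt0 w : Ttw w (2 * pi) < 0.
Proof.
have [_ d2 _ _] := C1two_Ttw.
have [z _] := MVT_between (fun z _ => d2 w z)
  (is_derive_continuous (d2 w 0)) (is_derive_continuous (d2 w (2 * pi))).
rewrite {2}/Ttw (MP w).1 (M1P w).1 !mulr0 addr0 !oppr0 !addr0 => ->.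
rewrite pmulr_llt0// /Ttwth; have /andP[k0 _] := kap01 z.
have r3 : 0 < rr w (kap z) ^+ 3 by rewrite exprn_gt0// rr_gt0// kap01.
by rewrite !mulNr oppr_lt0 mulr_gt0// mulr_gt0 ?expR_gt0// mulr_gt0// invr_gt0.
Qed.

Lemma Lp_decr : {homo Lp : x y /~ x < y}.
Proof.
move=> x y xy; have [z _ E] := MVT_between (fun z _ => is_derive_Lp z)
  (is_derive_continuous (is_derive_Lp y)) (is_derive_continuous (is_derive_Lp x)).
by rewrite -subr_lt0 E nmulr_rlt0 ?subr_gt0// Lp'_lt0.
Qed.

Lemma Lp_small (e : R) : 0 < e -> exists2 W, 0 <= W & Lp W < e.
Proof.
have pi0 := pi_gt0 R; move=> e0.
have p10 : 0 < (p + 1) / 2 by rewrite divr_gt0// addr_gt0// (lt_trans _ p1).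
(* [c] is the value of [u = expR W - 1] making e^2 c / ((p + 1) / 2) equal to (2 pi)^2. By [kap_ge],
   [aa] exceeds c / ((p + 1) / 2) at every phase, so the period, which is 2 pi times some value of
   [rr], falls below [e]. *)
pose c := (2 * pi) ^+ 2 * ((p + 1) / 2) / e ^+ 2.
have c0 : 0 < c by rewrite divr_gt0 ?exprn_gt0// mulr_gt0// exprn_gt0.
exists (ln (1 + c)); first by rewrite ln_ge0// lerDl ltW.
set W := ln (1 + c); have eW : expR W = 1 + c by rewrite lnK// posrE addr_gt0.
have [z _] := Tt_MVT W 0 (2 * pi); rewrite Tt0 !subr0 -/(Lp W) => ->.
have k01 := kap01 z; have r0 := rr_gt0 W k01; have ar := aa_rr W k01.
have /andP[k0 k1] := k01; have kg := kap_ge p1 z.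
have a1 : c / ((p + 1) / 2) < aa W (kap z).
  rewrite ltr_pdivrMr// /aa eW (_ : 1 + c - 1 = c); last by rewrite addrC addKr.
  have ka : 1 <= kap z * ((p + 1) / 2) by rewrite -ler_pdivrMr// div1r.
  apply: (@le_lt_trans _ _ (c * (kap z * ((p + 1) / 2)))).
    by rewrite ler_peMr// ltW.
  by rewrite -subr_gt0 [ltRHS](_ : _ = (p + 1) / 2)//; ring.
rewrite -(@ltr_pXn2r _ 2)// ?nnegrE ?ltW ?mulr_gt0//.
rewrite exprMn -(@ltr_pM2r _ (aa W (kap z))); last exact: aa_gt0.
rewrite mulrAC [_ * aa _ _]mulrC ar mul1r.
apply: (@le_lt_trans _ _ (e ^+ 2 * (c / ((p + 1) / 2)))).
  rewrite /c le_eqVlt; apply/orP; left; apply/eqP; field.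
  by rewrite !gt_eqF// addr_gt0// (lt_trans _ p1).
by rewrite ltr_pM2l// exprn_gt0.
Qed.

Lemma Lp_surj (l : R) : 0 < l <= 2 * pi -> exists2 w, 0 <= w & Lp w = l.
Proof.
move=> /andP[l0 l2]; have [W W0 LW] := Lp_small l0.
have cL : {within `[0, W], continuous Lp}.
  by apply: continuous_subspaceT => x; apply: is_derive_continuous (is_derive_Lp x).
have [|x] := @IVT _ Lp _ _ l W0 cL.
  by rewrite Lp0 ge_min (ltW LW) orbT le_max l2.
by rewrite in_itv/= => /andP[x0 _] <-; exists x.
Qed.

Lemma two_pi_Lp w : 2 * pi - Lp w = (expR w - 1) * M w (2 * pi).
Proof. by rewrite /Lp /Tt opprB addrC subrK. Qed.

(** Each factor of [mm] is bounded below uniformly in the phase: [kappa] by [kap_ge], rr^2 by 1 /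
    expR W because [aa <= expR w] for [w >= 0], and [qq] by 1/2 because [rr <= 1]. This keeps the
    denominator of the amplitude away from zero. *)
Lemma M_ge w W : 0 <= w <= W ->
  2 * pi * (((p + 1) / 2)^-1 * (expR W)^-1 / 2) <= M w (2 * pi).
Proof.
move=> /andP[w0 wW]; have [_ d2 _ _] := CM.
have [z _] := MVT_between (fun z _ => d2 w z)
  (is_derive_continuous (d2 w 0)) (is_derive_continuous (d2 w (2 * pi))).
rewrite (MP w).1 !subr0 => ->; rewrite mulrC; apply: ler_wpM2r; first exact: ltW.
have k01 := kap01 z; have r0 := rr_gt0 w k01; have ar := aa_rr w k01.
have /andP[k0 k1] := k01.
have e1 : 1 <= expR w by rewrite (le_trans _ (expR_ge1Dx w))// lerDl.
have a1 : 1 <= aa w (kap z) by rewrite lerDl mulr_ge0 ?subr_ge0// ltW.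
have aW : aa w (kap z) <= expR W.
  rewrite (@le_trans _ _ (expR w)) ?ler_expR// /aa; nra.
have rE : rr w (kap z) ^+ 2 = (aa w (kap z))^-1.
  apply: (mulfI (lt0r_neq0 (lt_le_trans ltr01 a1))).
  by rewrite ar mulfV ?gt_eqF// (lt_le_trans ltr01).
have r2 : (expR W)^-1 <= rr w (kap z) ^+ 2.
  by rewrite rE lef_pV2 ?posrE ?expR_gt0// (lt_le_trans ltr01).
have r1 : rr w (kap z) <= 1.
  by rewrite -(@expr_le1 _ 2)//; [rewrite rE invf_le1// (lt_le_trans ltr01)|exact: ltW].
have q2 : 2^-1 <= qq w (kap z).
  by rewrite /qq lef_pV2 ?posrE ?addr_gt0// (_ : 2 = 1 + 1)// lerD2l.
have eW0 := expR_gt0 W.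
have i1 : 0 <= (expR W)^-1 by rewrite invr_ge0 ltW.
have i2 : 0 <= ((p + 1) / 2)^-1.
  by rewrite invr_ge0 divr_ge0// addr_ge0// ltW// (lt_trans _ p1).
rewrite /mm; apply: ler_pM => //; first exact: mulr_ge0.
by apply: ler_pM => //; exact: kap_ge.
Qed.

End Phase.


Lemma continuous2_slice {R : realType} (f : R -> R -> R) w :
  continuous2 f -> continuous (f w).
Proof.
move=> cf a; apply: (@continuous_comp_two _ _ (fun z => f z.1 z.2) (fun=> w) id).
- exact: cf.
- exact: cst_continuous.
- exact: cvg_id.
Qed.

(** * The oscillation and its C2 dependence on parameters *)

Section Oscillator.
Context {R : realType} (p : R) (p1 : 1 < p).

Local Notation kap := (kappa p).

(* By the energy identity, [om w (th t)] is the time derivative of [sin (th t)]. *)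
Definition om (w th : R) : R := cos th / rr w (kap th).
Definition omw (w th : R) : R := cos th * (2^-1 * kap th * expR w * rr w (kap th)).
Definition omth (w th : R) : R :=
  - (sin th * (1 + (expR w - 1) * `|sin th| `^ (p - 1))) * rr w (kap th).

Let rr_neq0 w th : rr w (kap th) != 0.
Proof. by rewrite gt_eqF// rr_gt0// kap01. Qed.

Let om_sqr w th : om w th ^+ 2 =
  cos th ^+ 2 + (expR w - 1) * ((1 - `|sin th| `^ (p + 1)) / ((p + 1) / 2)).
Proof.
rewrite -cos2_kap// /om expr_div_n; have ar := aa_rr w (kap01 p1 th).
have -> : (rr w (kap th) ^+ 2)^-1 = aa w (kap th).
  have r2 : rr w (kap th) ^+ 2 != 0 by rewrite expf_neq0.
  by apply: (mulIf r2); rewrite mulVf// ar.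
rewrite /aa; ring.
Qed.

Let is_derive_om_sqr (w th : R) : is_derive th 1 (fun th =>
    cos th ^+ 2 + (expR w - 1) * ((1 - `|sin th| `^ (p + 1)) / ((p + 1) / 2)))
  (- 2 * cos th * (sin th * (1 + (expR w - 1) * `|sin th| `^ (p - 1)))).
Proof.
have q0 : 0 < p - 1 by rewrite subr_gt0.
have pE : p + 1 = p - 1 + 2 by ring.
have dp := is_derive_abs_powR (sin th) q0.
have ds := is_derive_sin th.
have dps := @is_derive1_comp R (fun x => `|x| `^ (p - 1 + 2)) sin th _ _ dp ds.
have -> : (fun th => cos th ^+ 2 +
    (expR w - 1) * ((1 - `|sin th| `^ (p + 1)) / ((p + 1) / 2))) =
  (fun th => cos th ^+ 2) + (fun th => (expR w - 1) / ((p + 1) / 2) *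
     (1 - ((fun x => `|x| `^ (p - 1 + 2)) \o sin) th)).
  by apply/funext => x; rewrite /= pE fctE/=; ring.
apply: is_derive_eq; rewrite /GRing.scale/= -pE; field.
by rewrite gt_eqF// addr_gt0// (lt_trans _ p1).
Qed.

(** No derivative of [kappa] is available, so [om] is treated through its square: where [cos th] is
    nonzero, [om] is plus or minus the root of the expression in [om_sqr]. Where [cos th = 0] the
    root is singular, but there [om] vanishes and its slope is that of [cos] divided by [rr], for
    which continuity of [kappa] suffices. *)
Let is_derive_om_th (w th : R) : is_derive th 1 (om w) (omth w th).
Proof.
have r0 z := rr_gt0 w (kap01 p1 z).
have [c0|] := eqVneq (cos th) 0.
  have /is_derive1_caratheodory[g [gE cg g0]] := is_derive_cos th.
  apply: (@near_is_derive_slope _ _ _ _ (fun y => g y / rr w (kap y))).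
  - by near=> y; rewrite /om c0 mul0r subr0 mulrAC -gE c0 subr0.
  - apply: cvgM => //; apply: cvgV => //.
    exact: (continuous2_slice (continuous_rr p1)).
  - rewrite g0 /omth.
    (* Here [kappa = 1], hence [aa = expR w] and rr^2 expR w = 1: the slope - sin th / rr is the
       claimed [omth]. *)
    have s2 : sin th ^+ 2 = 1 by rewrite sin2cos2 c0 expr0n/= subr0.
    have s1 : `|sin th| = 1.
      by apply/eqP; rewrite -sqrp_eq1// real_normK ?num_real// s2.
    have := aa_rr w (kap01 p1 th); rewrite /aa s1 powR1.
    have -> : kap th = 1 by rewrite /kappa c0 eqxx.
    rewrite !mulr1 => ar; have r1 : rr w 1 != 0.
      by have := rr_neq0 w th; rewrite /kappa c0 eqxx.
    apply: (canLR (mulfK r1)); rewrite -mulrA -expr2 -mulNr -mulrA ar mulr1//.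
pose H (y : R) := cos y ^+ 2 + (expR w - 1) * ((1 - `|sin y| `^ (p + 1)) / ((p + 1) / 2)).
have sqrtH y : Num.sqrt (H y) = `|cos y| / rr w (kap y).
  by rewrite /H -om_sqr sqrtr_sqr /om normrM normfV [X in _ / X]gtr0_norm.
have dH : cos th != 0 -> is_derive th 1 (Num.sqrt \o H)
    ((2 * (`|cos th| / rr w (kap th)))^-1 *
     (- 2 * cos th * (sin th * (1 + (expR w - 1) * `|sin th| `^ (p - 1))))).
  move=> c0; have H0 : 0 < H th.
    by rewrite /H -om_sqr exprn_even_gt0//= mulf_neq0// invr_neq0.
  rewrite -sqrtH; exact: (is_derive1_comp (is_derive1_sqrt H0) (is_derive_om_sqr w th)).
rewrite neq_lt => /orP[] c0.
- have nE : \forall y \near th, (- (Num.sqrt \o H)) y = om w y.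
    have : \forall y \near th, cos y < 0 by exact: (cvgr_lt _ (@continuous_cos R th) _ c0).
    by apply: filterS => y c; rewrite fctE/= sqrtH ltr0_norm// mulNr opprK.
  apply: near_eq_is_derive nE _; have ? := dH (ltr0_neq0 c0).
  apply: is_derive_eq; rewrite /omth ltr0_norm//; field.
  by rewrite rr_neq0 ltr0_neq0.
- have nE : \forall y \near th, (Num.sqrt \o H) y = om w y.
    have : \forall y \near th, 0 < cos y by exact: (cvgr_gt _ (@continuous_cos R th) _ c0).
    by apply: filterS => y c; rewrite fctE/= sqrtH gtr0_norm.
  apply: near_eq_is_derive nE _; have ? := dH (lt0r_neq0 c0).
  apply: is_derive_eq; rewrite /omth gtr0_norm//; field.
  by rewrite rr_neq0 lt0r_neq0.
Unshelve. all: by end_near. Qed.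

Lemma C1two_om : C1two om omw omth.
Proof.
have csin := continuous2_snd (@continuous_sin R).
have ccos := continuous2_snd (@continuous_cos R).
have ckap := continuous_kap2 p1.
have crr := continuous_rr p1.
split.
- move=> w th; have dr := is_derive_rr w (kap01 p1 th).
  have dV := is_deriveV (f := rr^~ (kap th)) (rr_neq0 w th) dr.
  have -> : om^~ th = (fun v => cos th * (rr v (kap th))^-1) by [].
  apply: is_derive_eq; rewrite /omw /GRing.scale/=; field; exact: rr_neq0.
- by move=> w th; apply: is_derive_om_th.
- rewrite /omw; do ![apply: continuous2M]; first exact: ccos.
  + exact: continuous2_cst.
  + exact: ckap.
  + exact: continuous_expR2.
  + exact: crr.
- rewrite /omth; apply: continuous2M crr; apply: continuous2N; apply: continuous2M csin _.
  apply: continuous2D; first exact: continuous2_cst.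
  apply: continuous2M.
    by apply: continuous2D; [exact: continuous_expR2|exact: continuous2_cst].
  have q0 : 0 < p - 1 by rewrite subr_gt0.
  apply: (@continuous2_snd _ (fun th => `|sin th| `^ (p - 1))) => th.
  exact: (continuous_comp (@continuous_sin R th) (continuous_abs_powR q0 (x := sin th))).
Qed.

Context (M M1 M2 : R -> R -> R).
Hypothesis MP : primitive2 (fun w th => mm w (kap th)) M.
Hypothesis M1P : primitive2 (fun w th => mm1 w (kap th)) M1.
Hypothesis M2P : primitive2 (fun w th => mm2 w (kap th)) M2.
Context (Th : R -> R -> R).
Hypothesis ThP : forall w t, Tt M w (Th w t) = t.

Lemma ThD w t : Th w (t + Lp M w) = Th w t + 2 * pi.
Proof.
by apply: (@Tt_inj _ _ p1 _ _ _ MP M1P M2P w); rewrite (TtD2pi p1 MP M1P M2P) !ThP.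
Qed.

Lemma sin_ThD w t : sin (Th w (t + Lp M w)) = sin (Th w t).
Proof. by rewrite ThD mulr_natl sinD2pi. Qed.

Section TimeDerivative.
Variables (w B c : R).
Let ph (t : R) := Th w (B * t + c).

(** [B] is to be the rescaling of time by the root of [q x / s x], and [c] carries the shift by
    [a x]. The speed comes from implicit differentiation of [ThP] at fixed [w]. *)
Lemma is_derive_phase (t : R) : is_derive t 1 ph (B / rr w (kap (ph t))).
Proof.
have CT := C1two_Tt p1 MP M1P M2P.
have db (s : R) : is_derive s 1 (fun t : R => B * t + c) B.
  by apply: is_derive_eq; rewrite addr0 /GRing.scale/= mulr1.
have cph : {for t, continuous ph}.
  apply: (@continuous_implicit R R (Tt M) (fun=> w) (fun t => B * t + c)).
  - exact: C1two_continuous2 CT.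
  - exact: (Tt_incr p1 MP M1P M2P).
  - by move=> h; rewrite /ph ThP.
  - exact: cst_continuous.
  - exact: is_derive_continuous (db t).
have := is_derive_implicit (th := ph) (W := fun=> w) CT _ cph _ (is_derive_cst w t 1) (db t).
rewrite mulr0 subr0; apply; first exact: rr_neq0.
by move=> h; rewrite /ph ThP.
Qed.

Lemma is_derive_sin_phase (t : R) : is_derive t 1 (fun t => sin (ph t)) (B * om w (ph t)).
Proof.
have dp := is_derive_phase t.
have H := @is_derive1_comp R sin ph t _ _ (is_derive_sin (ph t)) dp.
by apply: (is_derive_eq H); rewrite /om mulrCA.
Qed.

Lemma is_derive_om_phase (t : R) : is_derive t 1 (fun t => om w (ph t))
  (- (B * (sin (ph t) * (1 + (expR w - 1) * `|sin (ph t)| `^ (p - 1))))).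
Proof.
have dp := is_derive_phase t.
have H := @is_derive1_comp R (om w) ph t _ _ (is_derive_om_th w (ph t)) dp.
by apply: (is_derive_eq H); rewrite /omth mulrACA mulfV ?rr_neq0//; ring.
Qed.

End TimeDerivative.

(** The phase is only known to be C1. But [cos] times its gradient equals om (db - Ttw dW): the
    division by [rr] is absorbed into [om], and [om] and [Ttw] are C1 in both variables, so the
    gradient of the sine is again C1. *)
Lemma C2on_sin_phase n (W b : 'rV[R]_n -> R) : C2on setT W -> C2on setT b ->
  C2on setT (fun x => sin (Th (W x) (b x))).
Proof.
move=> [dW HW HdW] [db Hb Hdb].
have CT := C1two_Tt p1 MP M1P M2P; have CTw := C1two_Ttw p1 MP M1P M2P.
pose th x := Th (W x) (b x).
have Hth := grad_implicit (th := th) CT (fun u v => rr_gt0 u (kap01 p1 v))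
  (fun x => ThP (W x) (b x)) HW Hb.
exists (fun i x => om (W x) (th x) * (db i x + (- 1) * Ttw M M1 (W x) (th x) * dW i x)).
  have Hs := grad_comp (phi := sin) (dphi := cos) Hth (fun x _ =>
    conj (is_derive_sin (th x)) (@continuous_cos R (th x))).
  apply: grad_ext_df openT _ Hs => i x _; rewrite /om; ring.
move=> i; apply: C1onM.
  apply: (C1on_comp2 C1two_om); [by exists dW|by eexists; exact: Hth].
apply: C1onD => //; apply: C1onM => //; apply: C1onM.
  exact/C2on_C1on/C2on_cst.
by apply: (C1on_comp2 CTw); [exists dW|eexists; exact: Hth].
Qed.

End Oscillator.

Lemma continuous2_slicel {R : realType} (f : R -> R -> R) a :
  continuous2 f -> continuous (f^~ a).
Proof.
move=> cf w; apply: (@continuous_comp_two _ _ (fun z => f z.1 z.2) id (fun=> a)).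
- exact: cf.
- exact: cvg_id.
- exact: cst_continuous.
Qed.

Section Powers.
Context {R : realType} {n : nat}.
Implicit Types (f : 'rV[R]_n -> R) (D : set 'rV[R]_n).

Lemma continuous_powR (r x : R) : 0 < x -> {for x, continuous (fun y : R => y `^ r)}.
Proof. by move=> x0; apply: is_derive_continuous (is_derive1_powR r x0). Qed.

Lemma C2on_powR D f (r : R) : (forall x, D x -> 0 < f x) -> C2on D f ->
  C2on D (fun x => f x `^ r).
Proof.
move=> f0 Cf; apply: (@C2on_comp _ _ D f (fun y => y `^ r) (fun y => r * y `^ (r - 1))
  (fun y => r * ((r - 1) * y `^ (r - 1 - 1)))) => // x /f0 fx0; split.
- exact: is_derive1_powR.
- have ? := is_derive1_powR (r - 1) fx0.
  by apply: is_derive_eq.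
- by do 2!(apply: cvgM; first exact: cvg_cst); apply: continuous_powR.
Qed.

End Powers.

(** * The properties of the oscillator used by the construction *)

Section Packaging.
Context {R : realType} (p : R) (p1 : 1 < p).

(* For each [w >= 0] the function [t |-> c * y w t] with [c `^ (p - 1) = expR w - 1]
   solves [z'' + z + `|z| `^ (p - 1) * z = 0] and has period [L w]. *)
Record oscillator (y y' : R -> R -> R) (L Mb : R -> R) : Prop := Oscillator {
  osc_periodic : forall w t, y w (t + L w) = y w t ;
  osc_le1 : forall w t, `|y w t| <= 1 ;
  osc_top : forall w, exists t, y w t = 1 ;
  osc_derive : forall w B c t : R,
    is_derive t 1 (fun t => y w (B * t + c)) (B * y' w (B * t + c)) ;
  osc_derive2 : forall w B c t : R,
    is_derive t 1 (fun t => y' w (B * t + c))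
      (- (B * (y w (B * t + c) *
                (1 + (expR w - 1) * `|y w (B * t + c)| `^ (p - 1))))) ;
  osc_C2 : forall n (W b : 'rV[R]_n -> R), C2on setT W -> C2on setT b ->
    C2on setT (fun x => y (W x) (b x)) ;
  osc_period_surj : forall l, 0 < l <= 2 * pi -> exists2 w, 0 <= w & L w = l ;
  osc_period_C2 : forall n (W : 'rV[R]_n -> R), C2on setT (fun x => L (W x)) -> C2on setT W ;
  osc_period_small : forall e, 0 < e -> exists2 W, 0 <= W & L W < e ;
  osc_period_decr : {homo L : x y /~ x < y} ;
  osc_defect : forall w, 2 * pi - L w = (expR w - 1) * Mb w ;
  osc_defect_C2 : forall n (W : 'rV[R]_n -> R), C2on setT W -> C2on setT (fun x => Mb (W x)) ;
  osc_defect_ge : forall W, exists2 c, 0 < c & forall w, 0 <= w <= W -> c <= Mb w }.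

Lemma exists_oscillator : exists y y' L Mb, oscillator y y' L Mb.
Proof.
have [M MP] := exists_primitive2 (continuous_mm p1).
have [M1 M1P] := exists_primitive2 (continuous_mm1 p1).
have [M2 M2P] := exists_primitive2 (continuous_mm2 p1).
have [Th ThP] : {Th : R -> R -> R & forall w t, Tt M w (Th w t) = t}.
  have [Th ThP] := @choice (R * R)%type R (fun z th => Tt M z.1 th = z.2)
    (fun z => Tt_surj p1 MP M1P M2P z.1 z.2).
  by exists (fun w t => Th (w, t)) => w t; apply: (ThP (w, t)).
have CT := C1two_Tt p1 MP M1P M2P.
have CTw := C1two_Ttw p1 MP M1P M2P.
have CM := C1two_primitive2 (continuous_mm p1) (continuous_mm1 p1)
  (fun w a => is_derive_mm w (kap01 p1 a)) MP M1P.
have CM1 := C1two_primitive2 (continuous_mm1 p1) (continuous_mm2 p1)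
  (fun w a => is_derive_mm1 w (kap01 p1 a)) M1P M2P.
exists (fun w t => sin (Th w t)), (fun w t => om p w (Th w t)), (Lp M), (M^~ (2 * pi)).
split.
- by move=> w t; apply: (sin_ThD p1 MP M1P M2P ThP).
- by move=> w t; rewrite ler_norml sin_geN1 sin_le1.
- move=> w; exists (Tt M w (pi / 2)); rewrite (_ : Th w _ = pi / 2) ?sin_pihalf//.
  by apply: (@Tt_inj _ _ p1 _ _ _ MP M1P M2P w); rewrite ThP.
- by move=> w B c t; apply: (is_derive_sin_phase p1 MP M1P M2P ThP).
- by move=> w B c t; apply: (is_derive_om_phase p1 MP M1P M2P ThP).
- by move=> n W b; apply: (C2on_sin_phase p1 MP M1P M2P ThP).
- by move=> l; apply: (Lp_surj p1 MP M1P M2P).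
- move=> n W [dl Hl Hdl].
  (* [grad_implicit] asks for an increasing function, hence the sign in front of the decreasing
     period; the first variable is a dummy filled with the constant [0]. *)
  have CL : C1two (fun _ v => - Lp M v) (fun _ _ => 0) (fun _ v => - Ttw M M1 v (2 * pi)).
    split.
    + by move=> u v; apply: is_derive_cst.
    + by move=> u v; have ? := is_derive_Lp p1 MP M1P M2P v; apply: is_deriveN.
    + exact: continuous2_cst.
    + apply: continuous2N; have cT := C1two_continuous2 CTw.
      apply: (@continuous2_snd _ (fun v => Ttw M M1 v (2 * pi))) => v.
      by have [d _ _ _] := CTw; apply: is_derive_continuous (d v (2 * pi)).
  have Hb : grad setT (fun x => -1 * Lp M (W x)) (fun i x => 0 * Lp M (W x) + -1 * dl i x).
    exact: (gradM (@grad_cst _ _ setT (-1)) Hl).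
  have N0 v : 0 < - Ttw M M1 v (2 * pi) by rewrite oppr_gt0 (Lp'_lt0 p1 MP M1P M2P).
  have LE x : - Lp M (W x) = -1 * Lp M (W x) by rewrite mulN1r.
  have HW := grad_implicit (th := W) CL (fun _ v => N0 v) LE (@grad_cst R n setT 0) Hb.
  have {}HW : grad setT W (fun i x => dl i x * (Ttw M M1 (W x) (2 * pi))^-1).
    apply: grad_ext_df openT _ HW => i x _.
    by rewrite mul0r mulr0 add0r mulN1r subr0 invrN mulrNN.
  exists (fun i x => dl i x * (Ttw M M1 (W x) (2 * pi))^-1) => // i.
  apply: C1onM => //.
  have [d1 _ cTww _] := CTw.
  have T0 v : Ttw M M1 v (2 * pi) != 0 by rewrite ltr0_neq0// -oppr_gt0.
  eexists; apply: (@grad_comp _ _ _ W _ (fun v => (Ttw M M1 v (2 * pi))^-1)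
    (fun v => - (Ttw M M1 v (2 * pi)) ^- 2 *: Ttww M M1 M2 v (2 * pi)) HW) => x _; split.
    exact: is_deriveV.
  have c1 := continuous2_slicel (a := 2 * pi) (C1two_continuous2 CTw) (x := W x).
  have c2 := continuous2_slicel (a := 2 * pi) cTww (x := W x).
  apply: cvgM => //; apply: cvgN; apply: cvgV; first by rewrite expf_neq0.
  exact: (cvgM c1 c1).
- by move=> e; apply: (Lp_small p1 MP M1P M2P).
- exact: (Lp_decr p1 MP M1P M2P).
- by move=> w; apply: two_pi_Lp.
- move=> n W CW; apply: (@C2on_comp _ _ _ W (M^~ (2 * pi)) (M1^~ (2 * pi)) (M2^~ (2 * pi)) CW).
  have [d1 _ _ _] := CM; have [d2 _ c2 _] := CM1.
  by move=> x _; split; [exact: d1|exact: d2|exact: (continuous2_slicel (a := 2 * pi) c2)].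
- move=> W; have e0 := expR_gt0 W; have pi0 := pi_gt0 R.
  have p0 : 0 < p + 1 by rewrite addr_gt0// (lt_trans _ p1).
  exists (2 * pi * (((p + 1) / 2)^-1 * (expR W)^-1 / 2)).
    by rewrite !(mulr_gt0, invr_gt0).
  by move=> w; apply: (M_ge p1 MP M1P).
Qed.

End Packaging.

(** * Radial functions near the origin *)

Section Punctured.
Context {R : realType} {n : nat}.

Definition punctured : set 'rV[R]_n := [set x | x != 0].

Lemma evec_neq0 i : evec i != 0 :> 'rV[R]_n.
Proof.
by apply/eqP => /rowP/(_ i); rewrite !mxE !eqxx; apply/eqP; rewrite oner_eq0.
Qed.

Lemma open_punctured : open punctured.
Proof.
have -> : punctured = ~` [set 0] by apply/seteqP; split=> x /=; [move/eqP|move=> /eqP].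
by apply: closed_openC; apply: accessible_closed_set1; apply: hausdorff_accessible;
  exact: norm_hausdorff.
Qed.

Lemma near_punctured (P : 'rV[R]_n -> Prop) :
  (forall x, punctured x -> P x) -> \forall x \near (0 : 'rV[R]_n)^', P x.
Proof. by move=> PP; rewrite near_withinE; near=> x; apply: PP. Unshelve. all: by end_near. Qed.

Lemma near_punctured_line (v : 'rV[R]_n) (P : 'rV[R]_n -> Prop) : v != 0 ->
  (\forall x \near (0 : 'rV[R]_n)^', P x) -> \forall r \near (0 : R)^', P (r *: v).
Proof.
move=> v0; rewrite !near_withinE => nP.
have cl := @continuous_line R n 0 v 0.
rewrite /continuous_at scale0r addr0 in cl.
have H : \forall r \near (0 : R), r *: v + 0 != 0 -> P (r *: v + 0) := cl _ nP.
apply: filterS H => r; rewrite addr0 => + r0; apply.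
by rewrite scaler_eq0 negb_or r0.
Qed.

(** On each coordinate line through the origin [is_derive_extension] gives the partial derivative
    [0], and the same limits make the extended gradient continuous. *)
Lemma grad_extension (f : 'rV[R]_n -> R) df : {for 0, continuous f} ->
  grad punctured f df -> (forall i, df i x @[x --> (0 : 'rV[R]_n)^'] --> 0) ->
  grad setT f (fun i x => if x == 0 then 0 else df i x).
Proof.
move=> cf Hf dfl x _; have [->|x0] := eqVneq x 0; last first.
  have H : grad punctured f (fun i x => if x == 0 then 0 else df i x).
    by apply: grad_ext_df open_punctured _ Hf => i y /negbTE->.
  by have [cfx H'] := H x x0; split => // i; have := H' i; rewrite (negbTE x0).
split=> // i; split; last first.
  rewrite /prop_for /continuous_at eqxx.
  apply/(@cvgrPdist_lt _ _ _ (nbhs (0 : 'rV[R]_n))) => e e0.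
  have /cvgrPdist_lt/(_ _ e0) := dfl i; rewrite near_withinE.
  apply: filterS => y; case: eqP => [_ _|/eqP y0]; first by rewrite subrr normr0.
  exact.
apply/is_derive_line.
have e0 := @evec_neq0 i.
apply: (@is_derive_extension _ _ (fun r => df i (r *: evec i + 0))).
- apply: (continuous_comp (@continuous_line _ _ 0 (evec i) 0)).
  by rewrite scale0r addr0.
- have := near_punctured_line e0 (near_punctured (fun y Dy => ((Hf y Dy).2 i).1)).
  apply: filterS => r Hr.
  have /is_derive_line := Hr => Hr'.
  have -> : (fun h : R => f (h *: evec i + 0)) =
      (fun h => f (h *: evec i + r *: evec i)) \o (fun h => h - r).
    by apply/funext => h /=; rewrite addr0 scalerBl subrK.
  have ds : is_derive r 1 (fun h : R => h - r) 1.
    by apply: is_derive_eq; rewrite subr0.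
  have Hr2 : is_derive (r - r) 1 (fun h : R => f (h *: evec i + r *: evec i))
      (df i (r *: evec i)).
    by rewrite subrr.
  have := @is_derive1_comp R (fun h => f (h *: evec i + r *: evec i)) (fun h => h - r)
    r _ _ Hr2 ds.
  by rewrite mulr1 addr0.
- apply/cvgrPdist_lt => e e1; have /cvgrPdist_lt/(_ _ e1) := dfl i.
  move=> /(near_punctured_line e0); apply: filterS => r; by rewrite addr0.
Qed.

End Punctured.

(** * The Euclidean norm and the unit radial field *)

Section EuclideanNorm.
Context {R : realType} {n : nat}.
Implicit Types (x y : 'rV[R]_n).

Local Notation D0 := (@punctured R n).

Lemma sum_sqr_ge0 x : 0 <= \sum_(k < n) x 0 k ^+ 2.
Proof. by apply: sumr_ge0 => k _; apply: sqr_ge0. Qed.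

Lemma sum_sqr_gt0 x : x != 0 -> 0 < \sum_(k < n) x 0 k ^+ 2.
Proof.
move=> x0; rewrite lt_neqAle sum_sqr_ge0 andbT eq_sym.
apply: contra x0; rewrite psumr_eq0; last by move=> k _; apply: sqr_ge0.
move=> /allP H; apply/eqP/rowP => k; rewrite mxE.
by have := H k (mem_index_enum _); rewrite /= sqrf_eq0 => /eqP.
Qed.

Lemma enorm_gt0 x : x != 0 -> 0 < enorm x.
Proof. by move=> /sum_sqr_gt0; rewrite -sqrtr_gt0. Qed.

Lemma enorm0 : enorm (0 : 'rV[R]_n) = 0.
Proof. by rewrite /enorm big1 ?sqrtr0// => k _; rewrite mxE expr0n. Qed.

Lemma enormZ a x : enorm (a *: x) = `|a| * enorm x.
Proof.
rewrite /enorm -sqrtr_sqr -sqrtrM ?sqr_ge0// mulr_sumr; congr Num.sqrt.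
by apply: eq_bigr => k _; rewrite mxE exprMn.
Qed.

Lemma enorm_evec i : enorm (evec i : 'rV[R]_n) = 1.
Proof.
rewrite /enorm (bigD1 i)//= big1 ?addr0; last first.
  by move=> k ki; rewrite mxE (negbTE ki) andbF expr0n.
by rewrite mxE !eqxx expr1n sqrtr1.
Qed.

Lemma coord_le_enorm x i : `|x 0 i| <= enorm x.
Proof.
rewrite -sqrtr_sqr ler_sqrt ?sum_sqr_ge0//.
by rewrite (bigD1 i)//= lerDl; apply: sumr_ge0 => k _; apply: sqr_ge0.
Qed.

Lemma grad_sum D (F : 'I_n -> 'rV[R]_n -> R) dF : (forall k, grad D (F k) (dF k)) ->
  grad D (fun x => \sum_(k < n) F k x) (fun i x => \sum_(k < n) dF k i x).
Proof.
move=> HF; elim: (index_enum _) => [|a r IH].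
  have -> : (fun x => \sum_(k <- [::]) F k x) = (fun=> 0).
    by apply/funext => x; rewrite big_nil.
  have -> : (fun i x => \sum_(k <- [::]) dF k i x) = (fun _ _ => 0).
    by apply/funext => i; apply/funext => x; rewrite big_nil.
  exact: grad_cst.
have -> : (fun x => \sum_(k <- a :: r) F k x) = (fun x => F a x + \sum_(k <- r) F k x).
  by apply/funext => x; rewrite big_cons.
have -> : (fun i x => \sum_(k <- a :: r) dF k i x) =
    (fun i x => dF a i x + \sum_(k <- r) dF k i x).
  by apply/funext => i; apply/funext => x; rewrite big_cons.
exact: gradD.
Qed.

Lemma grad_sum_sqr D : grad D (fun x => \sum_(k < n) x 0 k ^+ 2) (fun i x => 2 * x 0 i).
Proof.
have H k : grad D (fun x : 'rV[R]_n => x 0 k ^+ 2)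
    (fun i x => (k == i)%:R * x 0 k + x 0 k * (k == i)%:R).
  exact: (gradM (@grad_coord R n D k) (@grad_coord R n D k)).
have := grad_sum H; congr (grad _ _ _); apply/funext => i; apply/funext => x.
rewrite (bigD1 i)//= eqxx big1 ?addr0; first by rewrite mul1r mulr1 mulr_natl mulr2n.
by move=> k /negbTE->; rewrite mul0r mulr0 addr0.
Qed.

(** The coordinates of x / |x|, which off the origin are also the partial derivatives of the norm.
    At the origin the value is [0]. *)
Definition nvec k x : R := x 0 k * (enorm x)^-1.

Lemma nvec_le1 k x : `|nvec k x| <= 1.
Proof.
have [->|x0] := eqVneq x 0; first by rewrite /nvec mxE mul0r normr0.
have e0 := enorm_gt0 x0.
by rewrite /nvec normrM normfV (gtr0_norm e0) ler_pdivrMr// mul1r coord_le_enorm.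
Qed.

Lemma grad_enorm : grad D0 enorm nvec.
Proof.
have H := grad_comp (phi := Num.sqrt) (dphi := fun y : R => (2 * Num.sqrt y)^-1)
  (@grad_sum_sqr D0).
apply: grad_ext_df open_punctured _ (H _).
  move=> i x /enorm_gt0 e0; rewrite -/(enorm x) /nvec; field; exact: lt0r_neq0.
move=> x /sum_sqr_gt0 s0; split; first exact: is_derive1_sqrt.
apply: cvgV; first by rewrite mulf_neq0// gt_eqF// sqrtr_gt0.
by apply: cvgM; [exact: cvg_cst|exact: sqrt_continuous].
Qed.

Lemma grad_enormV : grad D0 (fun x => (enorm x)^-1) (fun j x => - (enorm x) ^- 2 * nvec j x).
Proof.
apply: (grad_comp (phi := fun y : R => y^-1) (dphi := fun y : R => - y ^- 2) grad_enorm).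
move=> x /enorm_gt0 e0; split.
  have := is_deriveV (f := id) (lt0r_neq0 e0) (is_derive_id (enorm x) 1).
  by rewrite /GRing.scale/= mulr1.
apply: cvgN; apply: cvgV; first by rewrite expf_neq0// lt0r_neq0.
exact: exprn_continuous.
Qed.

Lemma grad_nvec k : grad D0 (nvec k)
  (fun j x => ((k == j)%:R - nvec k x * nvec j x) * (enorm x)^-1).
Proof.
apply: grad_ext_df open_punctured _ (gradM (@grad_coord R n D0 k) grad_enormV).
move=> j x /enorm_gt0/lt0r_neq0 e0; rewrite /nvec; field; exact: e0.
Qed.

Lemma grad_nvec2 k j : grad D0 (fun x => ((k == j)%:R - nvec k x * nvec j x) * (enorm x)^-1)
  (fun i x => - (((k == i)%:R - nvec k x * nvec i x) * nvec j x
      + nvec k x * ((j == i)%:R - nvec j x * nvec i x)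
      + ((k == j)%:R - nvec k x * nvec j x) * nvec i x) * (enorm x) ^- 2).
Proof.
have H1 := gradM (@grad_cst R n D0 (-1)) (gradM (grad_nvec k) (grad_nvec j)).
have H2 := gradD (@grad_cst R n D0 (k == j)%:R) H1.
have H3 := gradM H2 grad_enormV.
have := grad_ext_df open_punctured _ H3; under eq_fun do rewrite mulN1r; apply.
move=> i x /enorm_gt0/lt0r_neq0 e0; field; exact: e0.
Qed.

Lemma continuous_enorm : continuous (@enorm R n).
Proof.
move=> x; have [cS _] := @grad_sum_sqr setT x I.
exact: (continuous_comp cS (@sqrt_continuous R _)).
Qed.

End EuclideanNorm.

(** * Radial profiles times the unit radial field *)

Section Radial.
Context {R : realType} {n : nat} (o : 'I_n).
Implicit Types (x : 'rV[R]_n) (f : 'rV[R]_n -> R).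

Local Notation D0 := (@punctured R n).

Let e0 : evec o != 0 :> 'rV[R]_n := evec_neq0 o.

Lemma radialE f x : radial f -> f x = f (enorm x *: evec o).
Proof.
move=> rf; apply: rf; rewrite enormZ enorm_evec mulr1 ger0_norm// sqrtr_ge0//.
Qed.

Lemma is_derive_ray f df (r : R) : grad D0 f df -> r != 0 ->
  is_derive r 1 (fun r => f (r *: evec o)) (df o (r *: evec o)).
Proof.
move=> Hf r0; have re0 : D0 (r *: evec o) by rewrite /punctured/= scaler_eq0 negb_or r0.
have [_ /(_ o)[/is_derive_line Hr _]] := Hf _ re0.
have -> : (fun r => f (r *: evec o)) =
    (fun h : R => f (h *: evec o + r *: evec o)) \o (fun h => h - r).
  by apply/funext => h /=; rewrite scalerBl subrK.
have ds : is_derive r 1 (fun h : R => h - r) 1 by apply: is_derive_eq; rewrite subr0.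
have Hr2 : is_derive (r - r) 1 (fun h : R => f (h *: evec o + r *: evec o)) (df o (r *: evec o)).
  by rewrite subrr.
by have := @is_derive1_comp R _ (fun h => h - r) r _ _ Hr2 ds; rewrite mulr1.
Qed.

(** Chain rule through [enorm] for the profile on the ray of [evec o]; bounds on this one ray
    thereby hold in all directions. *)
Lemma radial_grad f df x j : radial f -> grad D0 f df -> x != 0 ->
  df j x = df o (enorm x *: evec o) * nvec j x.
Proof.
move=> rf Hf x0; have ex := enorm_gt0 x0.
have [_ /(_ j)[dj _]] := Hf x x0.
have [_ /(_ j)[/is_derive_line dn _]] := grad_enorm x0.
have dr := is_derive_ray Hf (lt0r_neq0 ex).
rewrite -(derive_val (is_derive := dj)) {dj}; apply: derive_val; apply/is_derive_line.
have dr' : is_derive (enorm (0 *: evec j + x)) 1 (fun r => f (r *: evec o))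
    (df o (enorm x *: evec o)) by rewrite scale0r add0r.
have := @is_derive1_comp R _ (fun h => enorm (h *: evec j + x)) 0 _ _ dr' dn.
by apply: is_derive1_ext => h /=; rewrite -radialE.
Qed.

Section RadialField.
Context (h : 'rV[R]_n -> R) (dh : 'I_n -> 'rV[R]_n -> R) (ddh : 'I_n -> 'I_n -> 'rV[R]_n -> R).
Hypothesis rh : radial h.
Hypothesis h00 : h 0 = 0.
Hypothesis Hh : grad D0 h dh.
Hypothesis Hdh : forall i, grad D0 (dh i) (ddh i).
Hypothesis ch : {for 0, continuous h}.
Hypothesis dh0 : forall i, dh i x @[x --> (0 : 'rV[R]_n)^'] --> 0.
Hypothesis ddh0 : forall i j, ddh i j x @[x --> (0 : 'rV[R]_n)^'] --> 0.

Let H (r : R) : R := h (r *: evec o).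
Let H1 (r : R) : R := if r == 0 then 0 else dh o (r *: evec o).
Let H2 (r : R) : R := if r == 0 then 0 else ddh o o (r *: evec o).

Let cvg_ray (f : 'rV[R]_n -> R) : f x @[x --> (0 : 'rV[R]_n)^'] --> 0 ->
  f (r *: evec o) @[r --> (0 : R)^'] --> 0.
Proof.
move=> f0; apply/cvgrPdist_lt => e e1; have /cvgrPdist_lt/(_ _ e1) := f0.
by move=> /(near_punctured_line e0).
Qed.

Let is_derive_H (r : R) : is_derive r 1 H (H1 r).
Proof.
rewrite /H1; have [->|r0] := eqVneq r 0; last exact: is_derive_ray Hh r0.
apply: (@is_derive_extension _ _ (fun r => dh o (r *: evec o))).
- rewrite /H; have -> : (fun r => h (r *: evec o)) = h \o (fun r => r *: evec o + 0).
    by apply/funext => s /=; rewrite addr0.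
  apply: (continuous_comp (@continuous_line _ _ 0 (evec o) 0)).
  by rewrite scale0r addr0.
- by rewrite near_withinE; near=> s => s0; apply: is_derive_ray Hh s0.
- exact: cvg_ray.
Unshelve. all: by end_near. Qed.

Let is_derive_H1 (r : R) : is_derive r 1 H1 (H2 r).
Proof.
have H1E (s : R) : s != 0 -> is_derive s 1 H1 (ddh o o (s *: evec o)).
  move=> s0; apply: near_eq_is_derive (is_derive_ray (Hdh o) s0).
  have : \forall t \near s, t != 0 by exact: (cvgr_neq0 _ (@cvg_id _ (nbhs s)) s0).
  by apply: filterS => t /negbTE t0; rewrite /H1 t0.
rewrite /H2; have [->|r0] := eqVneq r 0; last exact: H1E.
apply: (@is_derive_extension _ _ (fun r => ddh o o (r *: evec o))).
- rewrite /prop_for /continuous_at {2}/H1 eqxx.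
  apply/cvgrPdist_lt => e e1; have /cvgrPdist_lt/(_ _ e1) := cvg_ray (dh0 o).
  rewrite near_withinE; apply: filterS => s; rewrite /H1.
  by case: eqP => [_ _|_]; [rewrite subrr normr0|apply].
- by rewrite near_withinE; near=> s => s0; apply: H1E.
- exact: cvg_ray.
Unshelve. all: by end_near. Qed.

(** Smallness of the second derivative is integrated twice along the ray from [H1 0 = 0] and
    [H 0 = 0], then carried to all directions by [radial_grad]. The gained powers |x| and |x|^2
    compensate the singularities 1/|x| and 1/|x|^2 of the derivatives of x / |x|. *)
Let small (e : R) : 0 < e -> \forall x \near (0 : 'rV[R]_n)^',
  `|h x| <= e * enorm x ^+ 2 /\ forall j, `|dh j x| <= e * enorm x.
Proof.
move=> e1; have /cvgrPdist_le/(_ _ e1) := cvg_ray (ddh0 o o).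
rewrite near_withinE => /nbhs_ballP[d /= d0 dP].
have H2e (r : R) : `|r| < d -> `|H2 r| <= e.
  move=> rd; rewrite /H2; case: eqP => [_|/eqP r0]; first by rewrite normr0 ltW.
  by have := dP r _ r0; rewrite sub0r normrN; apply; rewrite -ball_normE/= sub0r normrN.
have H1e (r : R) : `|r| < d -> `|H1 r| <= e * `|r|.
  move=> rd; apply: (@bounded_derive_le _ _ H2 `|r|) => //.
  - by move=> z zr; apply: H2e; apply: le_lt_trans rd.
  - by rewrite /H1 eqxx.
have He (r : R) : `|r| < d -> `|H r| <= e * `|r| ^+ 2.
  move=> rd; rewrite expr2 mulrA; apply: (@bounded_derive_le _ _ H1 `|r|) => //.
  - move=> z zr; apply: le_trans (H1e _ _) _; first exact: le_lt_trans rd.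
    by rewrite ler_wpM2l// ltW.
  - by rewrite /H scale0r.
have nd : \forall x \near (0 : 'rV[R]_n), enorm x < d.
  by apply: (cvgr_lt _ (@continuous_enorm R n 0)); rewrite enorm0.
rewrite near_withinE; apply: filterS nd => x xd x0.
have ex := enorm_gt0 x0; have nx : `|enorm x| = enorm x by rewrite gtr0_norm.
split=> [|j].
  by rewrite (radialE x rh); have := He (enorm x); rewrite nx; apply.
rewrite (radial_grad j rh Hh x0) normrM; have := H1e (enorm x).
rewrite nx /H1 (gt_eqF ex) => /(_ xd) H1x.
by rewrite -[leRHS]mulr1 ler_pM ?nvec_le1.
Qed.

Let dF k j x := dh j x * nvec k x +
  h x * (((k == j)%:R - nvec k x * nvec j x) * (enorm x)^-1).

Let ddF k j i x := (ddh j i x * nvec k x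
    + dh j x * (((k == i)%:R - nvec k x * nvec i x) * (enorm x)^-1)) +
  (dh i x * (((k == j)%:R - nvec k x * nvec j x) * (enorm x)^-1) +
   h x * (- (((k == i)%:R - nvec k x * nvec i x) * nvec j x
      + nvec k x * ((j == i)%:R - nvec j x * nvec i x)
      + ((k == j)%:R - nvec k x * nvec j x) * nvec i x) * (enorm x) ^- 2)).

Let grad_F k : grad D0 (fun x => h x * nvec k x) (dF k).
Proof. exact: (gradM Hh (grad_nvec k)). Qed.

Let grad_dF k j : grad D0 (dF k j) (ddF k j).
Proof.
exact: (gradD (gradM (Hdh j) (grad_nvec k)) (gradM Hh (grad_nvec2 k j))).
Qed.

Let proj_le2 k j x : `|(k == j)%:R - nvec k x * nvec j x| <= 2.
Proof.
rewrite (le_trans (ler_normB _ _))// (_ : 2 = 1 + 1)// lerD//.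
  by case: (k == j); rewrite ?normr1 ?normr0.
by rewrite normrM -[leRHS]mulr1 ler_pM ?nvec_le1.
Qed.

Let dF_cvg0 k j : dF k j x @[x --> (0 : 'rV[R]_n)^'] --> 0.
Proof.
apply/cvgrPdist_le => e e1; have e3 : 0 < e / 3 by rewrite divr_gt0.
have nd : \forall x \near (0 : 'rV[R]_n)^', enorm x < 1.
  rewrite near_withinE.
  have : \forall x \near (0 : 'rV[R]_n), enorm x < 1.
    by apply: (cvgr_lt _ (@continuous_enorm R n 0)); rewrite enorm0.
  exact: filterS.
have np : \forall x \near (0 : 'rV[R]_n)^', x != 0 by apply: near_punctured.
have := small e3; apply: filterS3 nd np => x x1 x0 [hx dhx].
have ex := enorm_gt0 x0; rewrite sub0r normrN.
have hk : `|h x * (((k == j)%:R - nvec k x * nvec j x) * (enorm x)^-1)| <= e / 3 * 2.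
  rewrite normrM [X in _ * X]normrM normfV (gtr0_norm ex) [leLHS]mulrA ler_pdivrMr//.
  apply: (@le_trans _ _ (e / 3 * enorm x ^+ 2 * 2)); first exact: ler_pM.
  rewrite mulrAC expr2 mulrA ler_pM2r// -[leRHS]mulr1 ler_pM2l ?mulr_gt0//.
  exact: ltW.
have dk : `|dh j x * nvec k x| <= e / 3.
  rewrite normrM -[leRHS]mulr1 ler_pM ?nvec_le1//.
  by rewrite (le_trans (dhx j))// -[leRHS]mulr1 ler_pM2l// ltW.
rewrite (le_trans (ler_normD _ _))//; lra.
Qed.

Let ddF_cvg0 k j i : ddF k j i x @[x --> (0 : 'rV[R]_n)^'] --> 0.
Proof.
(* The denominator is 1 + 2 + 2 + 6, from the bounds on the four terms of [ddF]; the 6 collects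
   three products of size at most 2. *)
apply/cvgrPdist_le => e e1; have e11 : 0 < e / 11 by rewrite divr_gt0.
have np : \forall x \near (0 : 'rV[R]_n)^', x != 0 by apply: near_punctured.
have /cvgrPdist_le/(_ _ e11) := ddh0 j i.
have := small e11; apply: filterS3 np => x x0 [hx dhx].
rewrite !sub0r !normrN => ddhx; have ex := enorm_gt0 x0.
have t1 : `|ddh j i x * nvec k x| <= e / 11.
  by rewrite normrM -[leRHS]mulr1 ler_pM ?nvec_le1.
have t2 a b c : `|dh a x * (((b == c)%:R - nvec b x * nvec c x) * (enorm x)^-1)| <= e / 11 * 2.
  rewrite normrM [X in _ * X]normrM normfV (gtr0_norm ex) [leLHS]mulrA ler_pdivrMr// [leRHS]mulrAC.
  exact: ler_pM.
have t3 : `|h x * (- (((k == i)%:R - nvec k x * nvec i x) * nvec j x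
      + nvec k x * ((j == i)%:R - nvec j x * nvec i x)
      + ((k == j)%:R - nvec k x * nvec j x) * nvec i x) * (enorm x) ^- 2)| <= e / 11 * 6.
  have ex2 : 0 < enorm x ^+ 2 by rewrite exprn_gt0.
  rewrite normrM [X in _ * X]normrM normrN normfV (gtr0_norm ex2) [leLHS]mulrA.
  rewrite ler_pdivrMr// [leRHS]mulrAC.
  apply: ler_pM => //.
  have u a b c : `|((a == b)%:R - nvec a x * nvec b x) * nvec c x| <= 2.
    by rewrite normrM -[leRHS]mulr1 ler_pM ?nvec_le1.
  have u' := u j i k; rewrite mulrC in u'.
  rewrite (_ : 6 = 2 + 2 + 2); last by ring.
  apply: le_trans (ler_normD _ _) _; apply: lerD; last exact: u.
  by apply: le_trans (ler_normD _ _) _; apply: lerD; [exact: u|].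
have s1 := t2 j k i; have s2 := t2 i k j.
apply: le_trans (ler_normD _ _) _.
rewrite (_ : e = e / 11 + e / 11 * 2 + (e / 11 * 2 + e / 11 * 6)).
  by apply: lerD; apply: le_trans (ler_normD _ _) _; apply: lerD.
by field.
Qed.

Lemma C2on_radial_field k : C2on setT (fun x => h x * nvec k x).
Proof.
have cF : {for 0, continuous (fun x => h x * nvec k x)}.
  rewrite /prop_for /continuous_at h00 mul0r.
  apply/(@cvgrPdist_lt _ _ _ (nbhs (0 : 'rV[R]_n))) => e e1.
  have := ch; rewrite /prop_for /continuous_at h00 => /cvgrPdist_lt/(_ _ e1).
  apply: filterS => x; rewrite !sub0r !normrN normrM; apply: le_lt_trans.
  by rewrite -[leRHS]mulr1 ler_pM ?nvec_le1.
exists (fun j x => if x == 0 then 0 else dF k j x).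
  exact: (grad_extension cF (grad_F k) (dF_cvg0 k)).
move=> j; exists (fun i x => if x == 0 then 0 else ddF k j i x).
apply: (grad_extension _ _ (ddF_cvg0 k j)).
- by have [_ /(_ j)[]] := grad_extension cF (grad_F k) (dF_cvg0 k) (x := 0) I.
- apply: grad_open_ext (grad_dF k j); first exact: open_punctured.
  by move=> x; rewrite inE /punctured/= => /negbTE->.
Qed.

End RadialField.

End Radial.

Section Quotients.
Context {R : realType} {n : nat}.
Implicit Types (f g : 'rV[R]_n -> R) (D : set 'rV[R]_n).

Lemma C2on_div D f g : (forall x, 0 < g x) -> C2on D f -> C2on D g ->
  C2on D (fun x => f x / g x).
Proof.
move=> g0 Cf Cg; have -> : (fun x => f x / g x) = (fun x => f x * g x `^ (-1)).
  by apply/funext => x; rewrite powR_inv1// ltW.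
by apply: C2onM => //; apply: C2on_powR.
Qed.

Lemma C2on_sqrt D f : (forall x, 0 < f x) -> C2on D f -> C2on D (fun x => Num.sqrt (f x)).
Proof.
move=> f0 Cf; have -> : (fun x => Num.sqrt (f x)) = (fun x => f x `^ 2^-1).
  by apply/funext => x; rewrite powR12_sqrt// ltW.
exact: C2on_powR.
Qed.

End Quotients.

(** * Vector-valued functions and functions on space-time *)

Section VectorValued.
Context {R : realType}.

Lemma continuous_rowP (T : topologicalType) m (F : T -> 'rV[R]_m) :
  (forall k, continuous (fun x => F x 0 k)) -> continuous F.
Proof.
move=> cF x; apply/(@cvgrPdist_le _ _ _ (nbhs x)) => e e0.
have H : \forall y \near x, forall k, `|F x 0 k - F y 0 k| <= e.
  by apply: filter_forall => k; have /cvgrPdist_le/(_ _ e0) := cF k x.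
apply: filterS H => y Hy.
rewrite /Num.Def.normr/= mx_normrE (bigmax_le _ (ltW e0))//= => -[i k] _.
by rewrite ord1 !mxE; apply: Hy.
Qed.

Lemma is_derive_rowP (V : normedModType R) m (F : V -> 'rV[R]_m) x v (d : 'I_m -> R) :
  (forall k, is_derive x v (fun y => F y 0 k) (d k)) -> is_derive x v F (\row_k d k).
Proof.
move=> HF; have dF : derivable F x v.
  by apply/derivable_mxP => i k; rewrite ord1; have [] := HF k.
split=> //; rewrite derive_mx//; apply/rowP => k; rewrite !mxE.
by have [_ <-] := HF k.
Qed.

Lemma C2_rowP n m (F : 'rV[R]_n -> 'rV[R]_m) :
  (forall k, C2on setT (fun x => F x 0 k)) -> C2 F.
Proof.
move=> CF; have {}CF k : C2 (fun x => F x 0 k) by apply/C2P.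
have dF i x : is_derive x (evec i) F (\row_k pd i (fun x => F x 0 k) x).
  apply: is_derive_rowP => k; have [_ /(_ i i)[dk _]] := CF k; exact: derivableP.
have pdF i : pd i F = (fun x => \row_k pd i (fun x => F x 0 k) x).
  by apply/funext => x; have [_] := dF i x.
have ddF i j x : is_derive x (evec j) (pd i F) (\row_k pd j (pd i (fun x => F x 0 k)) x).
  rewrite pdF; apply: is_derive_rowP => k.
  have -> : (fun y => (\row_k0 pd i (fun x => F x 0 k0) y) 0 k) = pd i (fun x => F x 0 k).
    by apply/funext => y; rewrite mxE.
  have [_ /(_ i j)[_ [_ [dk _]]]] := CF k; exact: derivableP.
split.
  by apply: continuous_rowP => k; have [] := CF k.
move=> i j; split; first by move=> x; have [] := dF i x.
split.
  rewrite pdF; apply: continuous_rowP => k; have [_ /(_ i i)[_ [c _]]] := CF k.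
  by under eq_fun do rewrite mxE.
split; first by move=> x; have [] := ddF i j x.
have -> : pd j (pd i F) = (fun x => \row_k pd j (pd i (fun x => F x 0 k)) x).
  by apply/funext => x; have [_] := ddF i j x.
apply: continuous_rowP => k; have [_ /(_ i j)[_ [_ [_ c]]]] := CF k.
by under eq_fun do rewrite mxE.
Qed.

Lemma grad_lsubmx n m (f : 'rV[R]_n -> R) df : grad setT f df ->
  grad setT (fun z : 'rV[R]_(n + m) => f (lsubmx z))
    (fun i z => match fintype.split i with inl j => df j (lsubmx z) | inr _ => 0 end).
Proof.
move=> Hf z _; have cl : continuous (fun z : 'rV[R]_(n + m) => lsubmx z).
  by move=> y; apply: differentiable_continuous; apply: differentiable_lsubmx.
have [cf Hf'] := Hf (lsubmx z) I; split.
  exact: (continuous_comp (cl z) cf).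
move=> i; case: (split_ordP i) => j ij; subst i.
- have [/is_derive_line dj cdj] := Hf' j; split; last exact: (continuous_comp (cl z) cdj).
  apply/is_derive_line; apply: is_derive1_ext dj => h /=.
  congr f; apply/rowP => k; rewrite !mxE/= eq_lshift//.
- split; last exact: cst_continuous.
  apply/is_derive_line; apply: (is_derive1_ext (f := fun=> f (lsubmx z))).
    move=> h /=; congr f; apply/rowP => k; rewrite !mxE/= eq_lrshift mulr0 add0r//.
Qed.

Lemma C2on_lsubmx n m (f : 'rV[R]_n -> R) : C2on setT f ->
  C2on setT (fun z : 'rV[R]_(n + m) => f (lsubmx z)).
Proof.
move=> [df Hf Hdf]; eexists; first exact: (grad_lsubmx Hf).
move=> i /=; case: (fintype.split i) => [j|_]; last exact/C2on_C1on/C2on_cst.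
by have [ddf Hddf] := Hdf j; eexists; apply: (grad_lsubmx Hddf).
Qed.

End VectorValued.

(** * Radial fields are curl free *)

Section Curl.
Context {R : realType}.

Lemma curl_eq0 (F : 'rV[R]_3 -> 'rV[R]_3) x :
  (forall i k, pd i F x 0 k = pd k F x 0 i) -> curl F x = 0.
Proof.
move=> H; apply/rowP => k; rewrite !mxE.
by case: ifP => _; [rewrite H subrr|case: ifP => _; rewrite H subrr].
Qed.

Lemma curl_cst0 : curl (fun _ : 'rV[R]_3 => 0) = (fun=> 0).
Proof.
by apply/funext => x; apply: curl_eq0 => i k; rewrite /pd !derive_cst !mxE.
Qed.

(** The gradient of [phi] is parallel to [x], so off the origin the derivative of component [k] in
    direction [i] is symmetric in [i] and [k]. The origin is reached by continuity of the partial
    derivatives, which is why [F] is C1 on the whole space while [phi] is only considered off the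
    origin. *)
Lemma curl_radial (phi : 'rV[R]_3 -> R) (F : 'rV[R]_3 -> 'rV[R]_3) : radial phi ->
  C1on (@punctured R 3) phi -> (forall x k, F x 0 k = phi x * nvec k x) ->
  (forall k, C1on setT (fun x => F x 0 k)) -> curl F = (fun=> 0).
Proof.
move=> rphi [dphi Hphi] FE CF.
have [dF HF] := @choice _ _ (fun k dF => grad setT (fun x => F x 0 k) dF) CF.
have pdE i x k : pd i F x 0 k = dF k i x.
  have H : is_derive x (evec i) F (\row_k dF k i x).
    by apply: is_derive_rowP => j; have [_ /(_ i)[]] := HF j x I.
  by have [_] := H; rewrite /pd => ->; rewrite mxE.
have sym x i k : x != 0 -> dF k i x = dF i k x.
  move=> x0.
  have dE j l : dF j l x = dphi i0 (enorm x *: evec i0) * nvec l x * nvec j x +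
      phi x * (((j == l)%:R - nvec j x * nvec l x) * (enorm x)^-1).
    rewrite -(radial_grad i0 l rphi Hphi x0).
    rewrite -(derive_grad l (HF j) I).
    have -> : (fun x => F x 0 j) = (fun x => phi x * nvec j x).
      by apply/funext => y; rewrite FE.
    exact: (derive_grad l (gradM Hphi (grad_nvec j)) x0).
  by rewrite !dE eq_sym; ring.
apply/funext => x; apply: curl_eq0 => i k; rewrite !pdE.
have [->{x}|x0] := eqVneq x 0; last exact: sym.
pose g (r : R) := dF k i (r *: evec i0 + 0) - dF i k (r *: evec i0 + 0).
have cg : {for 0, continuous g}.
  have [_ /(_ i)[_ c1]] := HF k (0 *: evec i0 + 0) I.
  have [_ /(_ k)[_ c2]] := HF i (0 *: evec i0 + 0) I.
  have cl := @continuous_line R 3 0 (evec i0) 0.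
  exact: (cvgB (continuous_comp cl c1) (continuous_comp cl c2)).
have g0 : g 0 = dF k i 0 - dF i k 0 by rewrite /g scale0r addr0.
apply/eqP; rewrite -subr_eq0 -g0; apply/eqP; apply: contrapT => /eqP gn0.
have gn : \forall r \near (0 : R), g r != 0 by exact: (cvgr_neq0 _ cg gn0).
have /nbhs_ballP[d /= d0 dP] := gn.
have d2 : ball 0 d (d / 2).
  by rewrite -ball_normE/= sub0r normrN gtr0_norm ?divr_gt0// ltr_pdivrMr// ltr_pMr// ltr1n.
have := dP _ d2; rewrite /g addr0 sym ?subrr ?eqxx//.
by rewrite scaler_eq0 negb_or gt_eqF ?divr_gt0//= evec_neq0.
Qed.

End Curl.

(** * Construction of the breather *)

Section Breather.
Context {R : realType} (p : R) (s q V : 'rV[R]_3 -> R) (delta : R).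
Hypothesis p1 : 1 < p.
Hypothesis s0 : forall x, 0 < s x.
Hypothesis q0 : forall x, 0 < q x.
Hypothesis V0 : forall x, 0 < V x.
Hypothesis rs : radial s.
Hypothesis rq : radial q.
Hypothesis rV : radial V.
Hypothesis Cs : C2 s.
Hypothesis Cq : C2 q.
Hypothesis CV : C2 V.

Let T := 2 * pi * Num.sqrt (s 0 / q 0).
Let l x := T * Num.sqrt (q x / s x).
Let g x := `|2 * pi - l x|.
Let h x := g x `^ (1 / (p - 1)).

Hypothesis H1 : forall x, x != 0 -> l x < 2 * pi.
Hypothesis H2h : h x @[x --> (0 : 'rV[R]_3)] --> 0.
Hypothesis H2d : forall i : 'I_3, pd i h x @[x --> (0 : 'rV[R]_3)^'] --> 0.
Hypothesis H2dd : forall i j : 'I_3, pd j (pd i h) x @[x --> (0 : 'rV[R]_3)^'] --> 0.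
Hypothesis delta0 : 0 < delta.
Hypothesis H3 : exists M, forall x, g x * expR (delta * (p - 1) * enorm x) <= M.
Hypothesis H4 : exists M, forall x, q x / V x <= M.

Let pp0 : 0 < p - 1. Proof. by rewrite subr_gt0. Qed.
Let r0 : 0 < 1 / (p - 1). Proof. by rewrite div1r invr_gt0. Qed.

Let T0 : 0 < T.
Proof. by rewrite !mulr_gt0 ?pi_gt0// sqrtr_gt0 divr_gt0. Qed.

Let l_gt0 x : 0 < l x.
Proof. by rewrite mulr_gt0// sqrtr_gt0 divr_gt0. Qed.

Let l0 : l 0 = 2 * pi.
Proof.
rewrite /l /T -mulrA -sqrtrM ?divr_ge0 ?ltW// mulrA divfK ?gt_eqF//.
by rewrite divff ?gt_eqF// sqrtr1 mulr1.
Qed.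

Let l_le x : l x <= 2 * pi.
Proof. by have [->|/H1/ltW//] := eqVneq x 0; rewrite l0. Qed.

Let gE x : g x = 2 * pi - l x.
Proof. by rewrite /g ger0_norm// subr_ge0. Qed.

Let radial_l x y : enorm x = enorm y -> l x = l y.
Proof. by move=> e; rewrite /l (rq e) (rs e). Qed.

Let radial_h : radial h.
Proof. by move=> x y e; rewrite /h /g (radial_l e). Qed.

Let h0 : h 0 = 0.
Proof. by rewrite /h gE l0 subrr powR0// gt_eqF. Qed.

Let C2_l : C2on setT l.
Proof.
have Cqs : C2on setT (fun x => q x / s x) by apply: C2on_div => //; apply/C2P.
apply: (C2onM (C2on_cst setT T)); apply: C2on_sqrt => // x.
by rewrite divr_gt0.
Qed.

(** By (H1) the base of the power is positive off the origin, so any real exponent is harmless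
    there. *)
Let C2_h : C2on (@punctured R 3) h.
Proof.
have -> : h = (fun x => (2 * pi + - l x) `^ (1 / (p - 1))).
  by apply/funext => x; rewrite /h gE.
apply: C2on_powR => [x /H1|]; first by rewrite subr_gt0.
by apply: C2onD; [exact: C2on_cst|apply: C2onN; apply: C2onW C2_l].
Qed.

(** (H2) speaks of [pd], which agrees with the explicit derivatives on the open punctured space;
    this is all that a punctured limit sees. *)
Let C2_field k : C2on setT (fun x => h x * nvec k x).
Proof.
have [dh Hh Hdh] := C2_h.
have [ddh Hddh] := @choice _ _ (fun i ddh => grad (@punctured R 3) (dh i) ddh) Hdh.
have pdE i x : punctured x -> pd i h x = dh i x by move=> x0; apply: derive_grad Hh x0.
apply: (@C2on_radial_field _ _ i0 h dh ddh radial_h h0 Hh Hddh).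
- by rewrite /prop_for /continuous_at h0.
- move=> i; apply: cvg_trans (H2d i); apply: near_eq_cvg.
  by apply: near_punctured => x x0; apply: pdE.
- move=> i j; apply: cvg_trans (H2dd i j); apply: near_eq_cvg.
  apply: near_punctured => x x0; rewrite -(derive_grad j (Hddh i) x0).
  apply: near_eq_derive; apply: filterS (open_nbhs_nbhs (conj open_punctured x0)).
  by move=> y; apply: pdE.
Qed.

(** Serves to bound [W], and with it [K], uniformly in [x]. Beyond the radius [R0], (H3) forces
    [g <= pi], hence [l >= pi]; within it, radial symmetry reduces the minimum to a compact segment
    of one ray. *)
Let l_ge : exists2 e, 0 < e & forall x, e <= l x.
Proof.
have [M HM] := H3; have pi0 := pi_gt0 R.
pose d := delta * (p - 1); have d0 : 0 < d by rewrite mulr_gt0.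
(* Since [expR (d * r) >= d * r], the bound [M / expR (d * r)] on [g] is at most [pi] as soon as
   [r >= R0]. *)
pose R0 := `|M| / (pi * d).
have R00 : 0 <= R0 by rewrite divr_ge0// mulr_ge0// ltW.
have [df Hf _] := C2_l.
have cl : {within `[0, R0], continuous (fun r : R => l (r *: evec i0 + 0))}.
  apply: continuous_subspaceT => r.
  exact: (continuous_comp (@continuous_line R 3 0 (evec i0) r) (Hf _ I).1).
have [c c0 cP] := EVT_min R00 cl.
exists (Num.min pi (l (c *: evec i0 + 0))).
  by rewrite lt_min pi0 l_gt0.
move=> x; rewrite ge_min; have [xR|xR] := leP (enorm x) R0.
  have := cP (enorm x); rewrite in_itv/= xR sqrtr_ge0 => /(_ isT) H.
  apply/orP; right; rewrite (le_trans H)// le_eqVlt; apply/orP; left; apply/eqP.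
  by apply: radial_l; rewrite addr0 enormZ enorm_evec mulr1 ger0_norm// sqrtr_ge0.
apply/orP; left; suff : g x <= pi by rewrite gE; lra.
have e1 : `|M| <= pi * expR (d * enorm x).
  apply: (@le_trans _ _ (pi * (d * enorm x))).
    by rewrite mulrA -ler_pdivrMl ?mulr_gt0// mulrC ltW.
  by rewrite ler_pM2l// (le_trans _ (expR_ge1Dx _))// lerDr.
have e0 := expR_gt0 (d * enorm x).
rewrite -(ler_pM2r e0) (le_trans (HM x))// (le_trans (ler_norm _))//.
Qed.

Section Construction.
(** From here on [om] is a right inverse of the period map [L] on (0, 2 pi], not the velocity that
    bore this name above. *)
Context (y y' : R -> R -> R) (L Mb : R -> R) (om : R -> R).
Hypothesis osc : oscillator p y y' L Mb.
Hypothesis omP : forall t, 0 < t <= 2 * pi -> 0 <= om t /\ L (om t) = t.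

Let W x := om (l x).
Let B x := Num.sqrt (q x / s x).
Let K x := (q x / V x) `^ (1 / (p - 1)) * Mb (W x) `^ (- (1 / (p - 1))).

Let W0 x : 0 <= W x. Proof. by have [|] := omP (t := l x); rewrite ?l_gt0 ?l_le. Qed.

Let LW x : L (W x) = l x. Proof. by have [|] := omP (t := l x); rewrite ?l_gt0 ?l_le. Qed.

Let Mb_gt0 x : 0 < Mb (W x).
Proof.
have [c c0 cP] := osc_defect_ge osc (W x).
by rewrite (lt_le_trans c0)// cP// W0 lexx.
Qed.

Let B_gt0 x : 0 < B x. Proof. by rewrite sqrtr_gt0 divr_gt0. Qed.

Let K_gt0 x : 0 < K x. Proof. by rewrite mulr_gt0 ?powR_gt0 ?divr_gt0. Qed.

Let C2_W : C2on setT W.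
Proof.
apply: (osc_period_C2 osc); have -> : (fun x => L (W x)) = l by apply/funext.
exact: C2_l.
Qed.

Let C2_B : C2on setT B.
Proof.
apply: C2on_sqrt; first by move=> x; rewrite divr_gt0.
by apply: C2on_div => //; apply/C2P.
Qed.

Let C2_K : C2on setT K.
Proof.
apply: C2onM; apply: C2on_powR => //.
- by move=> x _; rewrite divr_gt0.
- by apply: C2on_div => //; apply/C2P.
- exact: (osc_defect_C2 osc C2_W).
Qed.

(* The amplitude is [K x * h x], where [(K x * h x) `^ (p - 1) = q x / V x * (expR (W x) - 1)];
   [K] is of class C2 everywhere, so that only [h x *: x / enorm x] is critical at the origin. *)
Definition bfield (x : 'rV[R]_3) (t : R) : 'rV[R]_3 :=
  (K x * y (W x) (B x * t) * h x * (enorm x)^-1) *: x.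

Lemma bfield_coord x t k :
  bfield x t 0 k = K x * y (W x) (B x * t) * (h x * nvec k x).
Proof. by rewrite mxE /nvec; ring. Qed.

Lemma enorm_bfield x t : enorm (bfield x t) = `|K x * y (W x) (B x * t) * h x|.
Proof.
rewrite enormZ normrM; have [->|x0] := eqVneq x 0.
  by rewrite h0 !(mulr0, normr0, mul0r).
by rewrite (gtr0_norm (x := _^-1)) ?invr_gt0 ?enorm_gt0// divfK// gt_eqF// enorm_gt0.
Qed.

(** The choice [L (W x) = l x] turns [g x] into (expR (W x) - 1) Mb (W x), and the factor [Mb]
    cancels against [K]. This matches the nonlinear coefficient with that of the normalized
    oscillator. *)
Lemma K_powR x : V x * (K x * h x) `^ (p - 1) = q x * (expR (W x) - 1).
Proof.
have q_ge : 0 <= q x by exact: ltW.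
have V_ge : 0 <= (V x)^-1 by rewrite invr_ge0 ltW.
rewrite !powRM ?powR_ge0 ?mulr_ge0 ?powR_ge0//.
rewrite -!powRrM mulNr div1r mulVf ?gt_eqF//.
rewrite powRN !powRr1 ?divr_ge0 ?normr_ge0 ?(ltW (q0 _)) ?(ltW (V0 _)) ?(ltW (Mb_gt0 _))//.
rewrite gE -LW (osc_defect osc).
field; rewrite gt_eqF ?Mb_gt0//= gt_eqF//.
Qed.

Lemma breather_bfield a : radial a -> C2 a ->
  breather s q V p T delta (fun x t => bfield x (t + a x)).
Proof.
move=> ra /C2P Ca.
have Hc x t k : bfield x (t + a x) 0 k =
    K x * y (W x) (B x * t + B x * a x) * (h x * nvec k x).
  by rewrite bfield_coord mulrDr.
split; [split|split].
- apply: C2_rowP => k.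
  have -> : (fun z => joint (fun x t => bfield x (t + a x)) z 0 k) =
    (fun z : 'rV[R]_(3 + 1) => K (lsubmx z) *
      y (W (lsubmx z)) (B (lsubmx z) * z 0 (rshift 3 ord0) + B (lsubmx z) * a (lsubmx z)) *
      (h (lsubmx z) * nvec k (lsubmx z))).
    by apply/funext => z; rewrite /joint Hc mxE.
  apply: C2onM; last exact: (C2on_lsubmx 1 (C2_field k)).
  apply: C2onM; first exact: (C2on_lsubmx 1 C2_K).
  apply: (osc_C2 osc); first exact: (C2on_lsubmx 1 C2_W).
  apply: C2onD; apply: C2onM.
  + exact: (C2on_lsubmx 1 C2_B).
  + exact: C2on_coord.
  + exact: (C2on_lsubmx 1 C2_B).
  + exact: (C2on_lsubmx 1 Ca).
- move=> x t.
  (* At fixed [t] the field is a radial profile times x / |x|; here the radial symmetry of the shift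
     [a] enters. *)
  have curl0 : curl (fun y => bfield y (t + a y)) = (fun=> 0).
    apply: (@curl_radial _ (fun x => K x * y (W x) (B x * t + B x * a x) * h x)).
    + move=> u v e.
      by rewrite /K /W /B (radial_l e) (rq e) (rV e) (rs e) (ra _ _ e) (radial_h e).
    + apply: C2on_C1on; apply: C2onM C2_h; apply: C2onM; first exact: C2onW C2_K.
      apply: (@C2onW _ _ setT) => //; apply: (osc_C2 osc C2_W).
      by apply: C2onD; apply: C2onM => //; exact: C2on_cst.
    + by move=> u k; rewrite Hc; ring.
    + move=> k; apply: C2on_C1on.
      have -> : (fun x => bfield x (t + a x) 0 k) =
        (fun x => K x * y (W x) (B x * t + B x * a x) * (h x * nvec k x)).
        by apply/funext => u; rewrite Hc.
      apply: C2onM (C2_field k); apply: C2onM C2_K _; apply: (osc_C2 osc C2_W).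
      by apply: C2onD; apply: C2onM => //; exact: C2on_cst.
  rewrite curl0 curl_cst0 addr0.
  pose ph (t : R) : R := B x * t + B x * a x.
  have d1 (t' : R) : is_derive t' 1 (fun tau => bfield x (tau + a x))
      (\row_k (K x * (h x * nvec k x) * (B x * y' (W x) (ph t')))).
    apply: is_derive_rowP => k; have dy := osc_derive osc (W x) (B x) (B x * a x) t'.
    have -> : (fun tau => bfield x (tau + a x) 0 k) = (fun tau =>
        K x * (h x * nvec k x) * y (W x) (B x * tau + B x * a x)).
      by apply/funext => tau; rewrite Hc; ring.
    by apply: is_derive_eq.
  have -> : dtt (fun x t => bfield x (t + a x)) x t = \row_k (K x * (h x * nvec k x) * (B x *
      (- (B x * (y (W x) (ph t) * (1 + (expR (W x) - 1) * `|y (W x) (ph t)| `^ (p - 1))))))).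
    rewrite /dtt; have -> : (fun t' => 'D_1 (fun tau => bfield x (tau + a x)) t') =
        (fun t' => \row_k (K x * (h x * nvec k x) * (B x * y' (W x) (ph t')))).
      by apply/funext => t'; have [_] := d1 t'.
    apply: derive_val; apply: is_derive_rowP => k.
    have dy := osc_derive2 osc (W x) (B x) (B x * a x) t.
    under eq_fun do rewrite mxE.
    by apply: is_derive_eq.
  have eN : enorm (bfield x (t + a x)) = K x * h x * `|y (W x) (ph t)|.
    rewrite enorm_bfield mulrDr -/(ph t) mulrAC normrM.
    by rewrite (ger0_norm (x := K x * h x))// mulr_ge0 ?powR_ge0// ltW.
  rewrite eN powRM ?mulr_ge0 ?powR_ge0 ?(ltW (K_gt0 _))// [V x * _]mulrA K_powR.
  apply/rowP => k; have := Hc x t k; rewrite -/(ph t).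
  move: (bfield x (t + a x)) => b bE; rewrite !mxE bE.
  (* With [s * B ^+ 2 = q], the two parts of the second time derivative cancel the linear and the
     nonlinear term. *)
  have sB : s x * B x ^+ 2 = q x.
    by rewrite sqr_sqrtr ?divr_ge0 ?ltW// mulrC divfK// gt_eqF.
  rewrite -sB; ring.
- move=> x t; rewrite /bfield.
  (* [B x * T = l x], and [W x] was chosen to make this the period of the oscillator at [x]: all
     points share the period [T]. *)
  have BT : B x * (t + T + a x) = B x * (t + a x) + L (W x) by rewrite LW /l -/(B x); ring.
  by rewrite BT (osc_periodic osc).
- have [M HM] := H3; have [N HN] := H4; have [e e0 le_] := l_ge.
  (* A parameter [W1] whose period lies below every [l x] bounds [W] from above, since the period
     decreases. *)
  have [W1 W10 LW1] := osc_period_small osc e0.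
  have WW1 x : W x <= W1.
    rewrite leNgt; apply/negP => /(osc_period_decr osc); rewrite LW => H.
    by have := le_ x; rewrite leNgt (lt_trans H LW1).
  have [c c0 cP] := osc_defect_ge osc W1.
  pose r := 1 / (p - 1).
  exists (N `^ r * c `^ (- r) * M `^ r) => x t.
  rewrite enorm_bfield normrM (ger0_norm (x := h x)) ?powR_ge0// -[leLHS]mulrA.
  have K_le : K x <= N `^ r * c `^ (- r).
    rewrite /K ler_pM ?powR_ge0//.
      have qV : 0 <= q x / V x by rewrite divr_ge0 ?ltW.
      by apply: ge0_ler_powR; rewrite ?nnegrE ?(ltW r0) ?(le_trans qV).
    rewrite !powRN lef_pV2 ?posrE ?powR_gt0//.
    by apply: ge0_ler_powR; rewrite ?nnegrE ?(ltW c0) ?(ltW (Mb_gt0 _)) ?(ltW r0)// cP// W0 WW1.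
  apply: ler_pM; rewrite ?mulr_ge0 ?powR_ge0 ?(ltW (expR_gt0 _))//.
    rewrite normrM (gtr0_norm (K_gt0 x)) -[leRHS]mulr1.
    by apply: ler_pM => //; [exact: ltW|exact: (osc_le1 osc)].
  (* Raising (H3) to the power [1 / (p - 1)] turns its weight into the required one. *)
  have -> : expR (delta * enorm x) = expR (delta * (p - 1) * enorm x) `^ r.
    rewrite -expRM /r; congr expR; field; exact: lt0r_neq0.
  have g_ge0 : 0 <= g x by exact: normr_ge0.
  have ge_ge0 : 0 <= g x * expR (delta * (p - 1) * enorm x).
    by rewrite mulr_ge0// ltW// expR_gt0.
  rewrite /h -/r -powRM ?(ltW (expR_gt0 _))//.
  apply: ge0_ler_powR; rewrite ?nnegrE//; first exact: ltW.
  exact: le_trans (HM x).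
Qed.

(** The zero field satisfies every clause of [breather], so nontriviality is recorded separately.
    Off the origin the amplitude is positive by (H1), and the profile attains [1]. *)
Lemma bfield_neq0 : exists x t, bfield x t != 0.
Proof.
have [t ty] := osc_top osc (W (evec i0)).
have e0 : evec i0 != 0 :> 'rV[R]_3 by exact: evec_neq0.
exists (evec i0), (t / B (evec i0)); apply/eqP => /(congr1 enorm).
rewrite enorm0 enorm_bfield mulrC [B _ * _]mulrC divfK ?gt_eqF// ty mulr1.
move/normr0_eq0/eqP; rewrite mulf_eq0 !gt_eqF// powR_gt0// gE subr_gt0 H1//.
Qed.

End Construction.

Lemma exists_breather : exists U : 'rV[R]_3 -> R -> 'rV[R]_3,
  (exists x t, U x t != 0) /\
  breather s q V p T delta U /\
  forall a : 'rV[R]_3 -> R, radial a -> C2 a ->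
    breather s q V p T delta (fun x t => U x (t + a x)).
Proof.
have [y [y' [L [Mb osc]]]] := exists_oscillator p1.
have [om omP] : {om : R -> R & forall t, 0 < t <= 2 * pi -> 0 <= om t /\ L (om t) = t}.
  apply: (@choice _ _ (fun t w => 0 < t <= 2 * pi -> 0 <= w /\ L w = t)) => t.
  have [t0|t0] := boolP (0 < t <= 2 * pi); last by exists 0.
  by have [w w0 Lw] := osc_period_surj osc t0; exists w.
exists (bfield y Mb om); split; first exact: (bfield_neq0 osc omP).
split; last by move=> a ra Ca; apply: (breather_bfield osc omP).
have -> : bfield y Mb om = (fun x t => bfield y Mb om x (t + (fun=> 0) x)).
  by apply/funext => x; apply/funext => t; rewrite addr0.
have rad0 : radial (fun _ : 'rV[R]_3 => 0 : R) by [].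
have C0 : C2 (fun _ : 'rV[R]_3 => 0 : R) by apply/C2P; exact: C2on_cst.
exact: (breather_bfield osc omP rad0 C0).
Qed.

End Breather.

Unset Implicit Arguments.

Theorem theorem1p1 (R : realType) (p : R) (s q V : 'rV[R]_3 -> R) (delta : R) :
  1 < p ->
  (forall x, 0 < s x) -> (forall x, 0 < q x) -> (forall x, 0 < V x) ->
  radial s -> radial q -> radial V ->
  C2 s -> C2 q -> C2 V ->
  let T := 2 * pi * Num.sqrt (s 0 / q 0) in
  let g := fun x => `|2 * pi - T * Num.sqrt (q x / s x)| in
  (* (H1) *)
  (forall x, x != 0 -> T * Num.sqrt (q x / s x) < 2 * pi) ->
  (* (H2): g^(1/(p-1)) -> 0 in the C^2 sense as x -> 0 *)
  (let h := fun x => g x `^ (1 / (p - 1)) in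
     h x @[x --> (0 : 'rV[R]_3)] --> 0 /\
     (forall i : 'I_3, pd i h x @[x --> (0 : 'rV[R]_3)^'] --> 0) /\
     (forall i j : 'I_3, pd j (pd i h) x @[x --> (0 : 'rV[R]_3)^'] --> 0)) ->
  (* (H3) *)
  0 < delta ->
  (exists M : R, forall x, g x * expR (delta * (p - 1) * enorm x) <= M) ->
  (* (H4) *)
  (exists M : R, forall x, q x / V x <= M) ->
  exists U : 'rV[R]_3 -> R -> 'rV[R]_3,
    (exists x t, U x t != 0) /\
    breather s q V p T delta U /\
    forall a : 'rV[R]_3 -> R, radial a -> C2 a ->
      breather s q V p T delta (fun x t => U x (t + a x)).
Proof.
move=> p1 s0 q0 V0 rs rq rV Cs Cq CV T g H1 [H2h [H2d H2dd]] delta0 H3 H4.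
exact: (exists_breather p1 s0 q0 V0 rs rq rV Cs Cq CV H1 H2h H2d H2dd delta0 H3 H4).
Qed.
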